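(* Let $1\le k\le n$, $x=(x',x'')\in\mathbb{R}^k\times\mathbb{R}^{n-k}$, $1<p,q<\infty$, $0<r<\infty$ with $p+q\ge r$, $\delta\in[0,1]\cap\left[\frac{r-q}{r},\frac{p}{r}\right]$, and $\alpha,b,c\in\mathbb{R}$ with $\frac{\delta r}{p}+\frac{(1-\delta)r}{q}=1$ and $c=-\delta+b(1-\delta)$. Then for every complex-valued $f\in C_0^\infty(\mathbb{R}^n\setminus\{x'=0\})$, $$\left|\frac{k-\alpha}{p}\right|^\delta\left\||x'|_k^{\alpha c/p}f\right\|_{L^r(\mathbb{R}^n)}\le\left[\left\|\frac{x'\cdot\nabla_kf}{|x'|_k^{\alpha/p}}\right\|_{L^p(\mathbb{R}^n)}^p-\int_{\mathbb{R}^n}C_p\!\left(\frac{x'\cdot\nabla_kf}{|x'|_k^{\alpha/p}},\frac{x'\cdot\nabla_kf}{|x'|_k^{\alpha/p}}+\frac{k-\alpha}{p}\frac{f}{|x'|_k^{\alpha/p}}\right)dx\right]^{\delta/p}\left\||x'|_k^{\alpha b/p}f\right\|_{L^q(\mathbb{R}^n)}^{1-\delta}$$ (the bracket being nonnegative). Moreover, when $\alpha\neq k$, the constant $\left|\frac{k-\alpha}{p}\right|^\delta$ is sharp in the case $q=p$ with $b=-1$, and in the cases $\delta\in\{0,1\}$.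
   Context: $|\cdot|_k$ is the Euclidean norm on $\mathbb{R}^k$, $\nabla_k=(\partial_{x_1},\dots,\partial_{x_k})$, $x'\cdot\nabla_kf=\sum_{j=1}^kx_j\partial_{x_j}f$. For complex $\xi,\eta$, $C_p(\xi,\eta):=|\xi|^p-|\xi-\eta|^p-p|\xi-\eta|^{p-2}\operatorname{Re}((\xi-\eta)\overline{\eta})$ (last term $0$ when $\xi=\eta$). Sharp means the constant on the left cannot be replaced by any larger constant. *)

(* Defs.v *)
From HB Require Import structures.
From mathcomp Require Import all_boot all_order all_algebra.
From mathcomp Require Import all_classical all_reals all_analysis.
Set Implicit Arguments. Unset Strict Implicit. Unset Printing Implicit Defensive.
Import Order.TTheory GRing.Theory Num.Theory.
Import numFieldNormedType.Exports.
Local Open Scope classical_set_scope.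
Local Open Scope ring_scope.

Section Defs.
Variable R : realType.

Definition cplx := (R * R)%type.
Definition cabs (z : cplx) : R := Num.sqrt (z.1 ^+ 2 + z.2 ^+ 2).
Definition cRe_mul_conj (z w : cplx) : R := z.1 * w.1 + z.2 * w.2.
Definition csub (z w : cplx) : cplx := (z.1 - w.1, z.2 - w.2).
Definition cadd (z w : cplx) : cplx := (z.1 + w.1, z.2 + w.2).
Definition cscale (a : R) (z : cplx) : cplx := (a * z.1, a * z.2).

Definition Cp (p : R) (xi eta : cplx) : R :=
  cabs xi `^ p - cabs (csub xi eta) `^ p -
  (if xi == eta then 0
   else p * cabs (csub xi eta) `^ (p - 2) * cRe_mul_conj (csub xi eta) eta).

(* Lebesgue integral over R^n = 'rV[R]_n of a nonnegative function, defined
   as the iterated one-dimensional Lebesgue integral (Tonelli). *)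
Fixpoint intRn (n : nat) : ('rV[R]_n -> \bar R) -> \bar R :=
  match n with
  | 0 => fun g => g 0
  | n'.+1 => fun g =>
      (\int[@lebesgue_measure R]_(t in setT)
         intRn (fun y : 'rV[R]_n' => g (row_mx (\row_(i < 1) t) y)))%E
  end.

Definition LnormRn (n : nat) (s : R) (g : 'rV[R]_n -> cplx) : R :=
  fine (intRn (fun x => (cabs (g x) `^ s)%:E)) `^ (s^-1).

Definition xnorm (n k : nat) (x : 'rV[R]_n) : R :=
  Num.sqrt (\sum_(i < n | (i < k)%N) x 0 i ^+ 2).

Definition partial (n : nat) (g : 'rV[R]_n -> R) (i : 'I_n) (x : 'rV[R]_n) : R :=
  'D_(delta_mx 0 i) g x.

Definition xgrad (n k : nat) (g : 'rV[R]_n -> R) (x : 'rV[R]_n) : R :=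
  \sum_(i < n | (i < k)%N) x 0 i * partial g i x.

Fixpoint iterD (n : nat) (vs : seq 'rV[R]_n) (g : 'rV[R]_n -> R) : 'rV[R]_n -> R :=
  match vs with
  | [::] => g
  | v :: vs' => iterD vs' ('D_v g)
  end.

Definition smooth (n : nat) (g : 'rV[R]_n -> R) : Prop :=
  forall (vs : seq 'rV[R]_n) (x : 'rV[R]_n), differentiable (iterD vs g) x.

(* f = u + i v belongs to C_0^infinity(R^n \ {x' = 0}) *)
Definition test_fun (n k : nat) (u v : 'rV[R]_n -> R) : Prop :=
  smooth u /\ smooth v /\
  exists K : set 'rV[R]_n, compact K /\ K `<=` [set x | xnorm k x != 0] /\
    (forall x, ~ K x -> u x = 0 /\ v x = 0).

Definition cfun (n : nat) (u v : 'rV[R]_n -> R) (x : 'rV[R]_n) : cplx := (u x, v x).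

Definition gradw (n k : nat) (p alpha : R) (u v : 'rV[R]_n -> R) (x : 'rV[R]_n) : cplx :=
  cscale ((xnorm k x `^ (alpha / p))^-1) (xgrad k u x, xgrad k v x).

Definition gradw_shift (n k : nat) (p alpha : R) (u v : 'rV[R]_n -> R) (x : 'rV[R]_n) : cplx :=
  cadd (gradw k p alpha u v x)
       (cscale ((k%:R - alpha) / p * (xnorm k x `^ (alpha / p))^-1) (cfun u v x)).

Definition bracket (n k : nat) (p alpha : R) (u v : 'rV[R]_n -> R) : R :=
  LnormRn p (gradw k p alpha u v) `^ p -
  fine (intRn (fun x => (Cp p (gradw k p alpha u v x) (gradw_shift k p alpha u v x))%:E)).

Definition wnorm (n k : nat) (s e : R) (u v : 'rV[R]_n -> R) : R :=
  LnormRn s (fun x => cscale (xnorm k x `^ e) (cfun u v x)).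

End Defs.

(* Main.v *)
Require Import Defs.
From HB Require Import structures.
From mathcomp Require Import all_boot all_order all_algebra.
From mathcomp Require Import all_classical all_reals all_analysis.
From mathcomp Require Import ring lra.
Set Implicit Arguments. Unset Strict Implicit. Unset Printing Implicit Defensive.
Import Order.TTheory GRing.Theory Num.Theory.
Import numFieldNormedType.Exports.
Local Open Scope classical_set_scope.
Local Open Scope ring_scope.

(** Put [m = (k - alpha)/p].  Integrating [x' . nabla_k |f|^p] by parts against
    [|x'|^-alpha] collapses the bracket to [|m|^p || |x'|^(-alpha/p) f ||_p^p],
    for every test function [f].  The inequality is then Hölder interpolation
    between the weighted [L^p] and [L^q] norms, and in the cases listed for
    sharpness it is an equality for every [f], so one [f <> 0] suffices.

    Only continuous compactly supported integrands occur; on them the iterated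
    integral is a positive linear functional whose slices depend continuously on
    the remaining variables.  Integration by parts is obtained by differentiating
    the scaling law of the integral under [x' |-> (1 + s) x']. *)

(** * Continuous functions with compact support on R^n *)

Section Slices.
Variable R : realType.

(** The number [k - alpha] is a divergence: [div (|x'|^-alpha x') = (k - alpha) |x'|^-alpha]. Hence
    the integral of [|x'|^-alpha |f|^(p-2) Re(conj f . x'.nabla_k f)] is [-m] times that of
    [|x'|^-alpha |f|^p]. The bracket contains the latter integral directly with factor
    [(1 - p) |m|^p], and the former one supplies the remaining [p |m|^p].

    The order of integration is fixed by the recursion on [n], so integrating by parts in one
    coordinate would require exchanging integrals or differentiating under them. A diagonal dilation
    acts on each coordinate separately and so passes through the recursion one variable at a time.
    Convexity then replaces differentiation of [|f|^p] under the integral: it involves only the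
    gradient [p |f|^(p-2) f], which for every [p > 1] is continuous even at the zeros of [f]. *)

Lemma cvg_rowP (T : Type) (F : set_system T) {FF : Filter F} n
    (f : T -> 'rV[R]_n) (l : 'rV[R]_n) :
  (forall i, (fun t => f t 0 i) @ F --> l 0 i) -> f @ F --> l.
Proof.
move=> fl A [B nB sBA]; rewrite /nbhs /=.
apply: (@filterS _ F _ [set t | forall i, B 0 i (f t 0 i)]).
  by move=> t Bt; apply: sBA => i j; rewrite (ord1 i); exact: Bt.
by apply: filter_forall => i; exact: fl.
Qed.

(** Literally the row formed in the recursion of [intRn], so that slices of an integrand unfold by
    conversion. *)
Definition cons_row n (t : R) (y : 'rV[R]_n) : 'rV[R]_n.+1 :=
  row_mx (\row_(i < 1) t) y.

Lemma cons_row0 n t (y : 'rV[R]_n) : cons_row t y 0 ord0 = t.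
Proof.
rewrite /cons_row (_ : ord0 = lshift n (ord0 : 'I_1)); last exact: val_inj.
by rewrite (@row_mxEl _ 1 1 n) mxE.
Qed.

Lemma cons_rowS n t (y : 'rV[R]_n) i : cons_row t y 0 (lift ord0 i) = y 0 i.
Proof.
rewrite /cons_row (_ : lift ord0 i = rshift 1 i); last exact: val_inj.
by rewrite (@row_mxEr _ 1 1 n).
Qed.

Lemma cons_row_continuous n :
  continuous (fun ty : R * 'rV[R]_n => cons_row ty.1 ty.2).
Proof.
move=> [t y] /=; apply: cvg_rowP => i.
case: (unliftP ord0 i) => [j|] ->.
  rewrite cons_rowS.
  under eq_fun do rewrite cons_rowS.
  apply: (@cvg_comp _ _ _ snd (fun y : 'rV[R]_n => y 0 j) _ (nbhs y)).
    exact: cvg_snd.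
  exact: coord_continuous.
rewrite cons_row0.
under eq_fun do rewrite cons_row0.
exact: cvg_fst.
Qed.

(** A tube argument: around each [(s0, y)] joint continuity gives a product neighbourhood on which
    both [Q s y'] and [Q s0 y'] are within [e / 2] of [Q s0 y], and compactness of [K] makes the
    neighbourhood of [s0] uniform. *)
Lemma compact_near_dist_lt (X Y : topologicalType) (Q : X -> Y -> R) (K : set Y) s0 :
  compact K ->
  (forall y, K y -> {for (s0, y), continuous (fun sy : X * Y => Q sy.1 sy.2)}) ->
  forall e : R, 0 < e ->
  \forall s \near s0, forall y, K y -> `|Q s y - Q s0 y| < e.
Proof.
move=> /compact_near_coveringP cK cQ e e0.
apply: (cK _ (nbhs s0) (fun s y => `|Q s y - Q s0 y| < e)) => y Ky.
have e20 : 0 < e / 2 by rewrite divr_gt0.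
have /cvgrPdist_lt /(_ _ e20) /= := cQ y Ky.
move=> [[A B] /= [nA nB] AB].
have As0 := nbhs_singleton nA.
exists (B, A) => //= -[y' s] [/= By' As].
have /= h1 := AB (s, y') (conj As By').
have /= h2 := AB (s0, y') (conj As0 By').
rewrite (_ : Q s y' - Q s0 y' = (Q s0 y - Q s0 y') - (Q s0 y - Q s y')); last by ring.
by rewrite (le_lt_trans (ler_normB _ _))// (splitr e) ltrD.
Qed.

(** Balls of the sup norm: the coordinatewise condition is inherited by slices with the same [M], so
    a single radius serves through the whole induction on the dimension. *)
Definition cube n (M : R) : set 'rV[R]_n := [set x | forall i, `|x 0 i| <= M].

Lemma cube_compact n M : compact (@cube n M).
Proof.
have := @rV_compact R n (fun=> `[- M, M]%classic) (fun=> @segment_compact _ _ _).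
suff -> : [set v : 'rV[R]_n | forall i, `[- M, M]%classic (v ord0 i)] = cube M by [].
by apply/seteqP; split => x /= h i; have := h i; rewrite in_itv /= ler_norml.
Qed.

Definition vanishes_off n (M : R) (g : 'rV[R]_n -> R) := forall x, ~ cube M x -> g x = 0.

Definition Cc n (g : 'rV[R]_n -> R) := continuous g /\ exists2 M : R, 0 < M & vanishes_off M g.

Lemma vanishes_off_le n (M M' : R) (g : 'rV[R]_n -> R) :
  M <= M' -> vanishes_off M g -> vanishes_off M' g.
Proof.
by move=> MM' h x xM; apply: h => xM1; apply: xM => i; rewrite (le_trans _ MM').
Qed.

Lemma CcD n (g h : 'rV[R]_n -> R) : Cc g -> Cc h -> Cc (fun x => g x + h x).
Proof.
move=> [cg [M M0 gM]] [ch [N N0 hN]]; split.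
  by move=> x; apply: continuousD; [exact: cg|exact: ch].
exists (Num.max M N); first by rewrite lt_max M0.
move=> x xM.
rewrite (vanishes_off_le _ gM xM) ?le_max ?lexx//.
by rewrite (vanishes_off_le _ hN xM) ?le_max ?lexx ?orbT// addr0.
Qed.

Lemma CcMl n (g h : 'rV[R]_n -> R) : continuous g -> Cc h -> Cc (fun x => g x * h x).
Proof.
move=> cg [ch [N N0 hN]]; split.
  by move=> x; apply: continuousM; [exact: cg|exact: ch].
by exists N => // x xM; rewrite hN// mulr0.
Qed.

Lemma CcZ n (a : R) (h : 'rV[R]_n -> R) : Cc h -> Cc (fun x => a * h x).
Proof. by move=> hh; apply: (@CcMl _ (fun=> a)) => //; exact: cst_continuous. Qed.

Lemma CcN n (h : 'rV[R]_n -> R) : Cc h -> Cc (fun x => - h x).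
Proof.
move=> hh; have := CcZ (-1) hh.
by rewrite (_ : (fun x => -1 * h x) = (fun x => - h x))//; apply/funext => x; rewrite mulN1r.
Qed.

Lemma CcB n (g h : 'rV[R]_n -> R) : Cc g -> Cc h -> Cc (fun x => g x - h x).
Proof. by move=> gg hh; apply: CcD => //; exact: CcN. Qed.

Lemma Cc_slice n (g : 'rV[R]_n.+1 -> R) t : Cc g -> Cc (fun y => g (cons_row t y)).
Proof.
move=> [cg [M M0 gM]]; split.
  move=> y; apply: (@continuous_comp _ _ _ (cons_row t)); last exact: cg.
  apply: (@cvg_rowP _ (nbhs y)) => i; case: (unliftP ord0 i) => [j|] ->.
    by under eq_fun do rewrite cons_rowS; rewrite cons_rowS; exact: coord_continuous.
  by under eq_fun do rewrite cons_row0; rewrite cons_row0; exact: cst_continuous.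
exists M => // y yM; apply: gM => h; apply: yM => i.
by have := h (lift ord0 i); rewrite cons_rowS.
Qed.

Lemma Cc_bounded n (g : 'rV[R]_n -> R) : Cc g -> exists c : R, forall x, `|g x| <= c.
Proof.
move=> [cg [M M0 gM]].
have : compact (g @` cube M).
  apply: continuous_compact; last exact: cube_compact.
  exact: continuous_subspaceT.
move=> /compact_bounded[c [_ hc]].
exists (Num.max 0 (c + 1)) => x; have [xM|xM] := pselect (cube M x).
  rewrite le_max; apply/orP; right.
  by apply: (hc (c + 1)); [rewrite ltrDl|exists x].
by rewrite gM// normr0 le_max lexx.
Qed.

(** Uniformity in [y] comes from compactness inside the cube; outside it both slices vanish. This is
    what makes slice integrals continuous in [t]. *)
Lemma near_slice n (g : 'rV[R]_n.+1 -> R) t (e : R) : Cc g -> 0 < e ->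
  \forall s \near t, forall y, `|g (cons_row s y) - g (cons_row t y)| < e.
Proof.
move=> [cg [M M0 gM]] e0.
have /= := @compact_near_dist_lt R 'rV[R]_n (fun s y => g (cons_row s y)) (@cube n M) t.
move=> /(_ (@cube_compact _ _) _ e e0) h.
have : \forall s \near t, forall y, cube M y ->
    `|g (cons_row s y) - g (cons_row t y)| < e.
  apply: h => y _.
  apply: (@continuous_comp _ _ _ (fun sy : R * 'rV[R]_n => cons_row sy.1 sy.2)).
    exact: cons_row_continuous.
  exact: cg.
apply: filterS => s hs y; have [yM|yM] := pselect (cube M y); first exact: hs.
have gy u : g (cons_row u y) = 0.
  by apply: gM => h'; apply: yM => i; have := h' (lift ord0 i); rewrite cons_rowS.
by rewrite !gy subrr normr0.
Qed.

End Slices.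

(** * One-dimensional integrals of continuous functions with bounded support *)

Section Integral.
Variable R : realType.
Local Notation mu := (@lebesgue_measure R).

Lemma Cc1_restrict (G : R -> R) (M : R) : (forall t, M < `|t| -> G t = 0) ->
  EFin \o G = (EFin \o G) \_ `[- M, M].
Proof.
move=> GM; apply/funext => t; rewrite patchE; case: ifPn => // /negP tM /=.
by rewrite GM// ltNge; apply/negP => h; apply: tM; rewrite inE /= in_itv/= -ler_norml.
Qed.

Lemma Cc1_integrable (G : R -> R) (M : R) : continuous G ->
  (forall t, M < `|t| -> G t = 0) -> mu.-integrable setT (EFin \o G).
Proof.
move=> cG GM; rewrite (Cc1_restrict GM) -integrable_mkcond//.
apply: continuous_compact_integrable; first exact: segment_compact.
exact: continuous_subspaceT.
Qed.

Lemma Cc1_Rintegral (G : R -> R) (M : R) : (forall t, M < `|t| -> G t = 0) ->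
  \int[mu]_t G t = \int[mu]_(t in `[- M, M]) G t.
Proof. by move=> GM; rewrite /Rintegral [in RHS]integral_mkcond -(Cc1_restrict GM). Qed.

Lemma Cc1_bound (G : R -> R) (M c : R) : continuous G -> 0 < M ->
  (forall t, M < `|t| -> G t = 0) -> (forall t, `|G t| <= c) ->
  `|\int[mu]_t G t| <= c * (2 * M).
Proof.
move=> cG M0 GM Gc; rewrite (Cc1_Rintegral GM).
have iG : mu.-integrable `[- M, M] (EFin \o G).
  apply: continuous_compact_integrable; first exact: segment_compact.
  exact: continuous_subspaceT.
have ic : mu.-integrable `[- M, M] (EFin \o cst c).
  apply: continuous_compact_integrable; first exact: segment_compact.
  by apply: continuous_subspaceT => x; exact: cvg_cst.
apply: (le_trans (le_normr_Rintegral _ iG)) => //.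
apply: (@le_trans _ _ (\int[mu]_(t in `[- M, M]) c)).
  apply: le_Rintegral => //.
  exact: (integrable_norm iG).
rewrite Rintegral_cst//= lebesgue_measure_itv/= lte_fin.
by rewrite (_ : - M < M) ?gtrN//= opprK -mulr2n mulr_natl.
Qed.

(** Continuity keeps [G] above [G t0 / 2] on an interval around [t0], and this rectangle bounds the
    integral from below. *)
Lemma Cc1_gt0 (G : R -> R) (M : R) : continuous G ->
  (forall t, M < `|t| -> G t = 0) -> (forall t, 0 <= G t) -> forall t0, 0 < G t0 ->
  0 < \int[mu]_t G t.
Proof.
move=> cG GM G0 t0 Gt0.
have iG := Cc1_integrable cG GM.
have e0 : 0 < G t0 / 2 by rewrite divr_gt0.
have /cvgrPdist_lt /(_ _ e0) /nbhs_ballP[d /= d0 hd] := cG t0.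
have hG t : t \in `[t0 - d / 2, t0 + d / 2] -> G t0 / 2 <= G t.
  rewrite in_itv/= => /andP[h1 h2].
  have : `|G t0 - G t| < G t0 / 2.
    by apply: hd; rewrite /ball/= ltr_norml; lra.
  by rewrite ltr_norml => /andP[_]; lra.
apply: (@lt_le_trans _ _ (\int[mu]_(t in `[t0 - d / 2, t0 + d / 2]) (G t0 / 2))).
  rewrite Rintegral_cst//= lebesgue_measure_itv/= lte_fin.
  rewrite (_ : t0 - d / 2 < t0 + d / 2); last by lra.
  by rewrite /= mulr_gt0//; lra.
apply: (@le_trans _ _ (\int[mu]_(t in `[t0 - d / 2, t0 + d / 2]) G t)).
  apply: le_Rintegral => //.
  - apply: continuous_compact_integrable; first exact: segment_compact.
    by apply: continuous_subspaceT => x; exact: cvg_cst.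
  - by apply: integrableS iG.
rewrite [leLHS]Rintegral_mkcond; apply: le_Rintegral => //.
- rewrite (_ : EFin \o _ = (EFin \o G) \_ `[t0 - d / 2, t0 + d / 2]); last first.
    by rewrite restrict_EFin.
  by rewrite -integrable_mkcond//; apply: integrableS iG.
- by move=> t _; rewrite patchE; case: ifPn.
Qed.

(** Bounded support reduces the claim to substitution between the intervals [[-M/l, M/l]] and
    [[-M, M]]. *)
Lemma Cc1_scale (G : R -> R) (M l : R) : 0 < l -> continuous G -> 0 < M ->
  (forall t, M < `|t| -> G t = 0) ->
  \int[mu]_t G (l * t) = l^-1 * \int[mu]_t G t.
Proof.
move=> l0 cG M0 GM.
have GlM t : M / l < `|t| -> G (l * t) = 0.
  by move=> h; apply: GM; rewrite normrM (gtr0_norm l0) -ltr_pdivrMl// mulrC.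
rewrite (Cc1_Rintegral GlM) (Cc1_Rintegral GM).
have derM : derive1 ( *%R l : R -> R) = cst l.
  by apply/funext => z; rewrite derive1Ml// derive1_id mulr1.
have := @integration_by_substitution_increasing R ( *%R l) G (- (M / l)) (M / l).
rewrite -/mu mulrN mulrCA divff ?gt_eqF// mulr1 => /(_ _ _ _ _ _ _ _) h.
rewrite [in RHS]/Rintegral h//.
- rewrite derM.
  under eq_integral do rewrite fctE/= mulrC EFinM.
  have ic : mu.-integrable `[- (M / l), M / l] (EFin \o (fun x => G (l * x))).
    apply: continuous_compact_integrable; first exact: segment_compact.
    apply: continuous_subspaceT => x; apply: continuous_comp; last exact: cG.
    exact: mulrl_continuous.
  by rewrite integralZl//= fineM//= ?mulKf ?gt_eqF//; exact: integrable_fin_num.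
- by rewrite ge0_cp// divr_ge0// ltW.
- by move=> a b _ _ ab; rewrite ltr_pM2l.
- by rewrite derM => z _; exact: cvg_cst.
- by rewrite derM; exact: is_cvg_cst.
- by rewrite derM; exact: is_cvg_cst.
- split => //.
  + by apply: cvg_at_right_filter; exact: mulrl_continuous.
  + by apply: cvg_at_left_filter; exact: mulrl_continuous.
- exact: continuous_subspaceT.
Qed.

End Integral.

(** * The iterated integral on compactly supported functions *)

Section IteratedIntegral.
Variable R : realType.
Local Notation mu := (@lebesgue_measure R).

(** [fine] sends infinite values to 0; the first component of [good] guarantees that this does not
    happen on [Cc]. *)
Definition RintRn n (g : 'rV[R]_n -> R) : R := fine (intRn (fun x => (g x)%:E)).

Definition slice n (g : 'rV[R]_n.+1 -> R) t := fun y => g (cons_row t y).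

(** The three properties have to be proved together. In dimension [n + 1] finiteness and linearity
    require the slice integral to be integrable in [t], hence continuous; its continuity follows
    from linearity and the bound in dimension [n], applied to the difference of two slices. *)
Let good n := [/\ forall g, @Cc R n g -> intRn (fun x => (g x)%:E) = (RintRn g)%:E,
  forall (a : R) g h, @Cc R n g -> @Cc R n h ->
    RintRn (fun x => a * g x + h x) = a * RintRn g + RintRn h
  & forall g (M c : R), Cc g -> 0 < M -> vanishes_off M g -> (forall x, `|g x| <= c) ->
     `|@RintRn n g| <= c * (2 * M) ^+ n].

Let slice_continuous n (g : 'rV[R]_n.+1 -> R) :
  good n -> Cc g -> continuous (fun t => RintRn (slice g t)).
Proof.
move=> [_ lin bnd] cg t; have [_ [M M0 gM]] := cg.
apply/cvgrPdist_le => e e0.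
have M20 : 0 < (2 * M) ^+ n by rewrite exprn_gt0// mulr_gt0.
(* [(2 * M) ^+ n] is the volume of the cube carrying the difference of two slices. *)
have d0 : 0 < e / (2 * M) ^+ n by rewrite divr_gt0.
have := near_slice t cg d0; apply: filterS => s hs.
have := lin (-1) (slice g s) (slice g t) (Cc_slice s cg) (Cc_slice t cg).
rewrite mulN1r addrC => <-.
rewrite -[leRHS](divfK (lt0r_neq0 M20)); apply: bnd => //.
- by apply: CcD; [apply: CcZ|]; exact: Cc_slice.
- move=> x xM; rewrite /slice !gM ?mulr0 ?addr0//;
    by move=> h; apply: xM => i; have := h (lift ord0 i); rewrite cons_rowS.
- by move=> x; rewrite ltW// mulN1r addrC distrC; exact: hs.
Qed.

Let slice_vanishes n (g : 'rV[R]_n.+1 -> R) (M t : R) :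
  vanishes_off M g -> M < `|t| -> forall y, slice g t y = 0.
Proof.
move=> gM tM y; apply: gM => /(_ ord0); rewrite cons_row0 leNgt tM.
by [].
Qed.

Let J0 n (g : 'rV[R]_n -> R) : (forall x, g x = 0) -> RintRn g = 0.
Proof.
rewrite /RintRn => g0; have -> : g = fun=> 0 by apply/funext.
suff -> : intRn (fun _ : 'rV[R]_n => 0%:E) = 0 :> \bar R by [].
elim: n {g g0} => //= n IH.
by under eq_integral do rewrite IH; rewrite integral0.
Qed.

Let intRnS n (g : 'rV[R]_n.+1 -> R) : good n -> Cc g ->
  intRn (fun x => (g x)%:E) = (\int[mu]_t (RintRn (slice g t)))%:E.
Proof.
move=> gn cg; have [fin _ _] := gn; have [_ [M M0 gM]] := cg.
have sM t : M < `|t| -> RintRn (slice g t) = 0.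
  by move=> tM; apply: J0; exact: slice_vanishes gM tM.
transitivity (\int[mu]_t (RintRn (slice g t))%:E)%E.
  by apply: eq_integral => t _; exact: (fin (slice g t) (Cc_slice t cg)).
rewrite /Rintegral fineK//; apply: integrable_fin_num => //.
exact: Cc1_integrable (slice_continuous gn cg) sM.
Qed.

Let good_all n : good n.
Proof.
elim: n => [|n gn].
  split => [g _|a g h _ _|g M c _ _ _ gc] //=.
  by rewrite expr0 mulr1 /RintRn /=; exact: gc.
have JS (g : 'rV[R]_n.+1 -> R) : Cc g -> RintRn g = \int[mu]_t (RintRn (slice g t)).
  by move=> cg; rewrite /RintRn (intRnS gn cg).
have int (g : 'rV[R]_n.+1 -> R) : Cc g ->
    mu.-integrable setT (EFin \o (fun t => RintRn (slice g t))).
  move=> cg; have [_ [M M0 gM]] := cg.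
  apply: (@Cc1_integrable R _ M (slice_continuous gn cg)) => t tM.
  by apply: J0; exact: slice_vanishes gM tM.
have [_ lin bnd] := gn.
split.
- by move=> g cg; rewrite (JS _ cg); exact: intRnS.
- move=> a g h cg ch; rewrite !JS//; last by apply: CcD => //; exact: CcZ.
  rewrite -RintegralZl//; last exact: int.
  rewrite -RintegralD//; last 2 first.
  + rewrite (_ : _ \o _ = EFin \o (fun t => RintRn (slice (fun x => a * g x) t))).
      by apply: int; exact: CcZ.
    apply/funext => t /=; congr EFin.
    have := lin a (slice g t) (fun=> 0) (Cc_slice t cg).
    rewrite (J0 (g := fun=> 0))// addr0 => <-; last first.
      by split; [exact: cst_continuous|exists 1].
    by congr RintRn; apply/funext => y; rewrite addr0.
  + exact: int.
  apply: eq_Rintegral => t _; rewrite -lin//; exact: Cc_slice.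
- move=> g M c cg M0 gM gc; rewrite (JS _ cg) exprS [2 * M * _]mulrC mulrA.
  apply: Cc1_bound => //; first exact: slice_continuous.
  + by move=> t tM; apply: J0; exact: slice_vanishes gM tM.
  + move=> t; apply: bnd => //; first exact: Cc_slice.
    * move=> y yM; apply: gM => h; apply: yM => i.
      by have := h (lift ord0 i); rewrite cons_rowS.
    * by move=> y; exact: gc.
Qed.

Lemma RintRn_linear n (a : R) (g h : 'rV[R]_n -> R) : Cc g -> Cc h ->
  RintRn (fun x => a * g x + h x) = a * RintRn g + RintRn h.
Proof. by have [_ H _] := good_all n; exact: H. Qed.

Lemma RintRn_bound n (g : 'rV[R]_n -> R) (M c : R) : Cc g -> 0 < M ->
  vanishes_off M g -> (forall x, `|g x| <= c) -> `|RintRn g| <= c * (2 * M) ^+ n.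
Proof. by have [_ _ H] := good_all n; exact: H. Qed.

Lemma RintRn_slice n (g : 'rV[R]_n.+1 -> R) : Cc g -> RintRn g = \int[mu]_t (RintRn (slice g t)).
Proof. by move=> cg; rewrite /RintRn (intRnS (good_all n) cg). Qed.

Lemma RintRn_slice_continuous n (g : 'rV[R]_n.+1 -> R) : Cc g ->
  continuous (fun t => RintRn (slice g t)).
Proof. exact: slice_continuous. Qed.

Lemma RintRn_slice_vanishes n (g : 'rV[R]_n.+1 -> R) (M t : R) :
  vanishes_off M g -> M < `|t| -> RintRn (slice g t) = 0.
Proof. by move=> gM tM; apply: J0; exact: slice_vanishes gM tM. Qed.

Lemma RintRn_cst0 n : RintRn (fun _ : 'rV[R]_n => 0) = 0.
Proof. exact: J0. Qed.

Lemma Cc_cst0 n : Cc (fun _ : 'rV[R]_n => 0).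
Proof. by split; [exact: cst_continuous|exists 1]. Qed.

Lemma RintRnZ n (a : R) (g : 'rV[R]_n -> R) : Cc g -> RintRn (fun x => a * g x) = a * RintRn g.
Proof.
move=> cg; have := RintRn_linear a cg (@Cc_cst0 n); rewrite RintRn_cst0 addr0 => <-.
by congr RintRn; apply/funext => x; rewrite addr0.
Qed.

Lemma RintRnD n (g h : 'rV[R]_n -> R) : Cc g -> Cc h ->
  RintRn (fun x => g x + h x) = RintRn g + RintRn h.
Proof.
move=> cg ch; have := RintRn_linear 1 cg ch; rewrite mul1r => <-.
by congr RintRn; apply/funext => x; rewrite mul1r.
Qed.

Lemma RintRnB n (g h : 'rV[R]_n -> R) : Cc g -> Cc h ->
  RintRn (fun x => g x - h x) = RintRn g - RintRn h.
Proof.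
move=> cg ch; rewrite RintRnD//; last exact: CcN.
have := RintRnZ (-1) ch; rewrite mulN1r => <-.
by congr (_ + RintRn _); apply/funext => x; rewrite mulN1r.
Qed.

Lemma RintRn_ge0 n (g : 'rV[R]_n -> R) : (forall x, 0 <= g x) -> 0 <= RintRn g.
Proof.
move=> g0; rewrite /RintRn fine_ge0//.
elim: n g g0 => [|n IH] g g0 /=; first by rewrite lee_fin.
by apply: integral_ge0 => t _; apply: (IH (slice g t)) => y; exact: g0.
Qed.

Lemma ler_RintRn n (g h : 'rV[R]_n -> R) : Cc g -> Cc h -> (forall x, g x <= h x) ->
  RintRn g <= RintRn h.
Proof.
move=> cg ch gh; rewrite -subr_ge0 -RintRnB//; apply: RintRn_ge0 => x.
by rewrite subr_ge0.
Qed.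

Lemma row_slice n (x : 'rV[R]_n.+1) : exists t y, x = cons_row t y.
Proof.
exists (x 0 ord0), (\row_j x 0 (lift ord0 j)); apply/rowP => i.
by case: (unliftP ord0 i) => [j|] ->; rewrite ?cons_rowS ?cons_row0// mxE.
Qed.

(** On the slice through [x0] the inner integral is positive by induction; it is continuous in [t],
    so the one-dimensional case applies to it. *)
Lemma RintRn_gt0 n (g : 'rV[R]_n -> R) x0 : Cc g -> (forall x, 0 <= g x) -> 0 < g x0 ->
  0 < RintRn g.
Proof.
elim: n g x0 => [|n IH] g x0 cg g0 gx0.
  by rewrite /RintRn /= (_ : 0 = x0)//; apply/rowP => -[].
have [_ [M M0 gM]] := cg; have [t [y xE]] := row_slice x0.
rewrite RintRn_slice//; apply: (@Cc1_gt0 R _ M _ _ _ t).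
- exact: RintRn_slice_continuous.
- by move=> s; exact: RintRn_slice_vanishes.
- by move=> s; apply: RintRn_ge0 => z; exact: g0.
- apply: (IH _ y); first exact: Cc_slice.
  + by move=> z; exact: g0.
  + by rewrite /slice -xE.
Qed.

Definition dilate n (d : 'I_n -> R) (x : 'rV[R]_n) : 'rV[R]_n := \row_i (d i * x 0 i).

Lemma dilate_continuous n (d : 'I_n -> R) : continuous (dilate d).
Proof.
move=> x; apply: (@cvg_rowP R _ (nbhs x)) => i; under eq_fun do rewrite mxE.
rewrite mxE; apply: cvgM; first exact: cst_continuous.
exact: coord_continuous.
Qed.

Lemma Cc_dilate n (d : 'I_n -> R) (g : 'rV[R]_n -> R) : (forall i, 0 < d i) ->
  Cc g -> Cc (g \o dilate d).
Proof.
move=> d0 [cg [M M0 gM]]; split.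
  by move=> x; apply: continuous_comp; [exact: dilate_continuous|exact: cg].
(* A positive radius that dominates every [M / d i] at once. *)
exists (1 + \sum_i (M / d i)).
  by rewrite ltr_pwDl// sumr_ge0// => i _; rewrite divr_ge0// ltW.
move=> x xM; apply: gM => h; apply: xM => i.
rewrite (bigD1 i)//= addrCA ler_wpDr//.
  by rewrite addr_ge0// sumr_ge0// => j _; rewrite divr_ge0// ltW.
have := h i; rewrite mxE normrM gtr0_norm// => hh.
by rewrite ler_pdivlMr// mulrC.
Qed.

(** A diagonal map commutes with slicing: each level of the recursion rescales its own variable and
    contributes one factor [(d i)^-1]. *)
Lemma RintRn_dilate n (d : 'I_n -> R) (g : 'rV[R]_n -> R) : (forall i, 0 < d i) -> Cc g ->
  RintRn (g \o dilate d) = (\prod_i d i)^-1 * RintRn g.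
Proof.
elim: n d g => [|n IH] d g d0 cg.
  rewrite big_ord0 invr1 mul1r /RintRn /=; congr (g _); apply/rowP => -[] //.
have [_ [M M0 gM]] := cg.
have cd := Cc_dilate d0 cg.
rewrite (RintRn_slice cg) (RintRn_slice cd).
transitivity (\int[mu]_t ((\prod_i d (lift ord0 i))^-1 * RintRn (slice g (d ord0 * t)))).
  apply: eq_Rintegral => t _; rewrite -(IH (fun i => d (lift ord0 i)))//; last exact: Cc_slice.
  congr RintRn; apply/funext => y; rewrite /slice /=; congr g; apply/rowP => i.
  rewrite mxE; case: (unliftP ord0 i) => [j|] ->; rewrite ?cons_rowS ?cons_row0//.
  by rewrite mxE.
have cG := RintRn_slice_continuous cg.
rewrite RintegralZl//; last first.
  apply: (@Cc1_integrable R (fun t => RintRn (slice g (d ord0 * t))) (M / d ord0)).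
    move=> t; apply: (@continuous_comp _ _ _ ( *%R (d ord0)) (fun t => RintRn (slice g t))).
      exact: mulrl_continuous.
    exact: cG.
  move=> t tM; apply: RintRn_slice_vanishes gM _.
  by rewrite normrM (gtr0_norm (d0 _)) -ltr_pdivrMl// mulrC.
rewrite (@Cc1_scale R (fun t => RintRn (slice g t)) M)//; last first.
  by move=> t; exact: RintRn_slice_vanishes.
by rewrite mulrA big_ord_recl invfM [in LHS](mulrC _^-1).
Qed.

End IteratedIntegral.

(** * Powers of the modulus and Hölder *)

Section Powers.
Variable R : realType.
Implicit Types z w : cplx R.

(** At a positive limit the power function is differentiable. At the limit 0 the exponent must be
    positive, and [f t < e]^ s^-1[then gives]f t [^ s < e]. *)
Lemma cvg_powR (T : Type) (F : set_system T) {FF : Filter F} (f : T -> R) (a s : R) :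
  (forall t, 0 <= f t) -> 0 <= a -> (0 < a) || (0 < s) -> f @ F --> a ->
  (fun t => f t `^ s) @ F --> a `^ s.
Proof.
move=> f0 a_ge0 as0.
have h : 0 < a -> f @ F --> a -> (fun t => f t `^ s) @ F --> a `^ s.
  move=> a0 fa; suff ca : {for a, continuous (fun b : R => b `^ s)}.
    exact: (cvg_comp _ _ fa ca).
  apply: differentiable_continuous; apply/derivable1_diffP.
  by apply: derivable_powR; rewrite in_itv/= a0.
move: a_ge0 as0; rewrite le_eqVlt => /predU1P[<-|/h {}h] /orP[|s0].
- by rewrite ltxx.
- move=> fa; rewrite powR0 ?gt_eqF//; apply/cvgrPdist_lt => e e0.
  have e10 : 0 < e `^ s^-1 by rewrite powR_gt0.
  have /cvgrPdist_lt /(_ _ e10) := fa; apply: filterS => t.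
  rewrite !sub0r !normrN !ger0_norm ?powR_ge0// => fe.
  have -> : e = (e `^ s^-1) `^ s by rewrite -powRrM mulVf ?gt_eqF// powRr1// ltW.
  by rewrite gt0_ltr_powR// nnegrE// ?powR_ge0.
- by move=> _; exact: h.
- exact: h.
Qed.

Lemma cabs_ge0 z : 0 <= cabs z. Proof. exact: sqrtr_ge0. Qed.

Lemma sqr_cabs z : cabs z ^+ 2 = z.1 ^+ 2 + z.2 ^+ 2.
Proof. by rewrite sqr_sqrtr// addr_ge0// sqr_ge0. Qed.

Lemma cabs_eq0 z : (cabs z == 0) = (z == (0, 0)).
Proof.
rewrite -[LHS](expf_eq0 _ 2) sqr_cabs paddr_eq0 ?sqr_ge0// !sqrf_eq0.
by case: z.
Qed.

Lemma cabs0 : cabs (0, 0) = 0 :> R.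
Proof. by apply/eqP; rewrite cabs_eq0. Qed.

Lemma cabsZ (a : R) z : cabs (Defs.cscale a z) = `|a| * cabs z.
Proof.
by rewrite /cabs /Defs.cscale/= !exprMn -mulrDr sqrtrM ?sqr_ge0// sqrtr_sqr.
Qed.

Lemma normr1_le_cabs z : `|z.1| <= cabs z.
Proof. by rewrite -sqrtr_sqr ler_sqrt ?lerDl ?sqr_ge0// addr_ge0// sqr_ge0. Qed.

Lemma normr2_le_cabs z : `|z.2| <= cabs z.
Proof. by rewrite -sqrtr_sqr ler_sqrt ?lerDr ?sqr_ge0// addr_ge0// sqr_ge0. Qed.

(** Cauchy-Schwarz in the plane, by Lagrange's identity. *)
Lemma cRe_mul_conj_le z w : cRe_mul_conj z w <= cabs z * cabs w.
Proof.
apply: (le_trans (ler_norm _)).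
rewrite -sqrtr_sqr -sqrtrM ?addr_ge0 ?sqr_ge0//.
rewrite ler_sqrt ?mulr_ge0 ?addr_ge0 ?sqr_ge0// /cRe_mul_conj -subr_ge0.
have -> : (z.1 ^+ 2 + z.2 ^+ 2) * (w.1 ^+ 2 + w.2 ^+ 2) - (z.1 * w.1 + z.2 * w.2) ^+ 2
  = (z.1 * w.2 - z.2 * w.1) ^+ 2 by ring.
exact: sqr_ge0.
Qed.

(** Young's inequality for [a]^ t[and]b [^ (1 - t)] with the conjugate exponents [t^-1] and
    [(1 - t)^-1]. *)
Lemma weighted_AMGM (a b t : R) : 0 <= a -> 0 <= b -> 0 < t < 1 ->
  a `^ t * b `^ (1 - t) <= t * a + (1 - t) * b.
Proof.
move=> a0 b0 /andP[t0 t1].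
have t10 : 0 < 1 - t by rewrite subr_gt0.
have := @conjugate_powR R (a `^ t) (b `^ (1 - t)) t^-1 (1 - t)^-1.
rewrite !powR_ge0 !invr_gt0 t0 t10 !invrK addrC subrK => /(_ _ _ _ _ _) h.
apply: (le_trans (h _ _ _ _ _)) => //.
by rewrite -!powRrM !divff ?gt_eqF// !powRr1// mulrC [b * _]mulrC.
Qed.

Lemma powR_tangent (a b p : R) : 0 < a -> 0 <= b -> 1 < p ->
  a `^ p + p * (a `^ (p - 1) * b - a `^ p) <= b `^ p.
Proof.
move=> a0 b0 p1; have p0 : 0 < p by lra.
have ip : 0 < p^-1 < 1 by rewrite invr_gt0 p0 invf_lt1.
have := @weighted_AMGM (b `^ p) (a `^ p) p^-1 (powR_ge0 _ _) (powR_ge0 _ _) ip.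
rewrite -!powRrM mulfV ?gt_eqF// powRr1// (_ : p * (1 - p^-1) = p - 1) => [h|]; last first.
  by rewrite mulrBr mulr1 mulfV ?gt_eqF.
have := ler_wpM2l (ltW p0) h.
have -> : p * (p^-1 * b `^ p + (1 - p^-1) * a `^ p) = b `^ p + (p - 1) * a `^ p.
  by field; rewrite gt_eqF.
rewrite [b * _]mulrC; lra.
Qed.

Lemma cabs_powR_tangent z w p : 1 < p ->
  cabs z `^ p + p * (cabs z `^ (p - 2) * cRe_mul_conj z (csub w z)) <= cabs w `^ p.
Proof.
move=> p1; have [/eqP|z0] := eqVneq (cabs z) 0.
  rewrite cabs_eq0 => /eqP ->; rewrite cabs0 powR0; last by rewrite gt_eqF//; lra.
  by rewrite /cRe_mul_conj/= !mul0r !addr0 !mulr0 addr0 powR_ge0.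
have a0 : 0 < cabs z by rewrite lt_def z0 cabs_ge0.
apply: le_trans (powR_tangent a0 (cabs_ge0 w) p1).
rewrite lerD2l ler_pM2l; last by lra.
have -> : cRe_mul_conj z (csub w z) = cRe_mul_conj z w - cabs z ^+ 2.
  by rewrite sqr_cabs /cRe_mul_conj/=; ring.
have -> : cabs z `^ (p - 1) = cabs z `^ (p - 2) * cabs z.
  rewrite -[X in _ * X]powRr1 ?cabs_ge0// -powRD ?z0 ?implybT//.
  by congr (_ `^ _); ring.
have -> : cabs z `^ p = cabs z `^ (p - 2) * cabs z ^+ 2.
  rewrite -powR_mulrn ?cabs_ge0// -powRD ?z0 ?implybT//.
  by congr (_ `^ _); ring.
by rewrite -mulrA -mulrBr ler_wpM2l ?powR_ge0// lerB// cRe_mul_conj_le.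
Qed.

Lemma cvg_cabs (T : Type) (F : set_system T) {FF : Filter F} (f g : T -> R) (a b : R) :
  f @ F --> a -> g @ F --> b -> (fun t => cabs (f t, g t)) @ F --> cabs (a, b).
Proof.
move=> fa gb.
apply: (@cvg_comp _ _ _ (fun t => f t ^+ 2 + g t ^+ 2) Num.sqrt F
  (nbhs (a ^+ 2 + b ^+ 2))).
  by apply: cvgD; exact: cvgM.
exact: sqrt_continuous.
Qed.

(* [z |-> |z|^(p-2) z] is continuous at 0 although [|z|^(p-2)] need not be. *)
Lemma cvg_cabs_powRM (T : Type) (F : set_system T) {FF : Filter F}
    (f g h : T -> R) (a b l p : R) : 1 < p ->
  (forall t, `|h t| <= cabs (f t, g t)) -> `|l| <= cabs (a, b) ->
  f @ F --> a -> g @ F --> b -> h @ F --> l ->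
  (fun t => cabs (f t, g t) `^ (p - 2) * h t) @ F --> cabs (a, b) `^ (p - 2) * l.
Proof.
move=> p1 hle lle fa gb hl.
have cab : (fun t => cabs (f t, g t)) @ F --> cabs (a, b) by exact: cvg_cabs.
have [z0|z0] := eqVneq (cabs (a, b)) 0; last first.
  apply: cvgM => //; apply: cvg_powR => //.
  - by move=> t; exact: cabs_ge0.
  - exact: cabs_ge0.
  - by rewrite lt_def z0 cabs_ge0.
have l0 : l = 0.
  by apply/eqP; rewrite -normr_eq0 eq_le normr_ge0 andbT (le_trans lle)// z0.
rewrite l0 mulr0; apply/norm_cvg0P.
have p10 : 0 < p - 1 by rewrite subr_gt0.
(* At a zero of the limit, [|h| <= |z|] bounds the product by [|z|^(p-1)], whose exponent is
   positive. *)
apply: (@squeeze_cvgr _ _ _ _ (cst 0) (fun t => cabs (f t, g t) `^ (p - 1))).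
- apply: nearW => t; rewrite normr_ge0 normrM ger0_norm ?powR_ge0//=.
  have [c0|c0] := eqVneq (cabs (f t, g t)) 0.
    have -> : h t = 0.
      by apply/eqP; rewrite -normr_eq0 eq_le normr_ge0 andbT (le_trans (hle t))// c0.
    by rewrite normr0 mulr0 powR_ge0.
  apply: (le_trans (ler_wpM2l (powR_ge0 _ _) (hle t))).
  rewrite -[X in _ * X]powRr1 ?cabs_ge0// -powRD ?c0 ?implybT//.
  by rewrite le_eqVlt; apply/orP; left; apply/eqP; congr (_ `^ _); ring.
- exact: cvg_cst.
- rewrite -[X in _ --> X](@powR0 R (p - 1)) ?gt_eqF// -[X in _ --> X `^ _]z0.
  apply: cvg_powR => //.
  - by move=> t; exact: cabs_ge0.
  - exact: cabs_ge0.
  - by rewrite p10 orbT.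
Qed.

(** After division of [F] and [G] by their integrals, the weighted mean inequality is applied
    pointwise and integrated. If one integral is 0, the corresponding function vanishes identically
    by continuity, and so does the left side. *)
Lemma RintRn_hoelder n (F G : 'rV[R]_n -> R) (t : R) : 0 < t < 1 ->
  (forall x, 0 <= F x) -> (forall x, 0 <= G x) -> Cc F -> Cc G ->
  Cc (fun x => F x `^ t * G x `^ (1 - t)) ->
  RintRn (fun x => F x `^ t * G x `^ (1 - t)) <= RintRn F `^ t * RintRn G `^ (1 - t).
Proof.
move=> t01 F0 G0 cF cG cFG; have /andP[t0 t1] := t01.
have t10 : 0 < 1 - t by rewrite subr_gt0.
have zero H : Cc H -> (forall x, 0 <= H x) -> ~~ (0 < @RintRn R n H) -> forall x, H x = 0.
  move=> cH H0 /negP JH x; apply/eqP/negPn/negP => Hx; apply: JH.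
  by apply: (RintRn_gt0 (x0 := x)) => //; rewrite lt_def Hx H0.
have [A0|/(zero _ cF F0) F00] := boolP (0 < RintRn F); last first.
  rewrite (_ : (fun x => _) = fun=> 0) ?RintRn_cst0 ?mulr_ge0 ?powR_ge0//.
  by apply/funext => x; rewrite F00 powR0 ?mul0r// gt_eqF.
have [B0|/(zero _ cG G0) G00] := boolP (0 < RintRn G); last first.
  rewrite (_ : (fun x => _) = fun=> 0) ?RintRn_cst0 ?mulr_ge0 ?powR_ge0//.
  by apply/funext => x; rewrite G00 [X in _ * X]powR0 ?mulr0// gt_eqF.
set C := RintRn F `^ t * RintRn G `^ (1 - t).
have C0 : 0 < C by rewrite mulr_gt0 ?powR_gt0.
apply: (@le_trans _ _ (RintRn (fun x => C * t / RintRn F * F x + C * (1 - t) / RintRn G * G x))).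
  apply: ler_RintRn => //; first by apply: CcD; exact: CcZ.
  move=> x.
  have := @weighted_AMGM (F x / RintRn F) (G x / RintRn G) t.
  rewrite !divr_ge0 ?(ltW A0) ?(ltW B0)// => /(_ isT isT t01).
  rewrite !powRM ?invr_ge0 ?(ltW A0) ?(ltW B0)// => h.
  have := ler_wpM2l (ltW C0) h.
  have eqV a s : 0 < a -> (a : R)^-1 `^ s * a `^ s = 1.
    by move=> a0; rewrite -powRM ?invr_ge0 ?ltW// mulVf ?gt_eqF// powR1.
  have -> : C * (F x `^ t * (RintRn F)^-1 `^ t * (G x `^ (1 - t) * (RintRn G)^-1 `^ (1 - t))) =
      F x `^ t * G x `^ (1 - t) *
      (((RintRn F)^-1 `^ t * RintRn F `^ t) * ((RintRn G)^-1 `^ (1 - t) * RintRn G `^ (1 - t))).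
    by rewrite /C; ring.
  rewrite !eqV// !mulr1; congr (_ <= _).
  by rewrite mulrDr; congr (_ + _); ring.
rewrite RintRnD ?RintRnZ//; try exact: CcZ.
rewrite !divfK ?gt_eqF//.
by rewrite -mulrDr addrC subrK mulr1.
Qed.

End Powers.

(** * Expansion along the dilation field *)

Section Radial.
Variables (R : realType) (n : nat).
Implicit Types (g : 'rV[R]_n -> R) (x v : 'rV[R]_n).

Lemma is_derive_line g x v (t : R) : differentiable g (x + t *: v) ->
  is_derive t 1 (fun s : R => g (x + s *: v)) ('D_v g (x + t *: v)).
Proof.
move=> dg; have dv : derivable g (x + t *: v) v by exact: diff_derivable.
have E : (fun h : R => h^-1 *: (((fun s : R => g (x + s *: v)) \o shift t) (h *: 1)
      - g (x + t *: v))) =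
    (fun h : R => h^-1 *: ((g \o shift (x + t *: v)) (h *: v) - g (x + t *: v))).
  apply/funext => h /=; congr (_ *: (g _ - _)).
  by rewrite [h *: 1]mulr1 scalerDl addrCA addrA.
by split; [rewrite /derivable E|rewrite /derive E].
Qed.

Definition proj k x : 'rV[R]_n := \row_i (if (i < k)%N then x 0 i else 0).

(** The base point [y] is independent of [x]: along the line [x + s *: proj k x] the point moves
    while the direction stays [proj k x]. For [y = x] the sum is [xgrad k g x]. *)
Lemma derive_proj k g x y : differentiable g y ->
  'D_(proj k x) g y = \sum_(i < n | (i < k)%N) x 0 i * partial g i y.
Proof.
move=> dg; rewrite deriveE//.
have -> : proj k x = \sum_(i < n | (i < k)%N) x 0 i *: delta_mx 0 i.
  rewrite [LHS]row_sum_delta [RHS]big_mkcond/=; apply: eq_bigr => i _.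
  by rewrite mxE; case: ifP => // _; rewrite scale0r.
rewrite linear_sum; apply: eq_bigr => i _.
by rewrite linearZ/= /partial deriveE.
Qed.

Lemma derive_off_closed (A : set 'rV[R]_n) g v x : closed A ->
  (forall y, ~ A y -> g y = 0) -> ~ A x -> 'D_v g x = 0.
Proof.
move=> cA g0 Ax; have oA : open (~` A) by exact: closed_openC.
rewrite (@near_eq_derive _ _ _ g (cst 0))//.
  by rewrite derive_cst.
near=> y; apply: g0; near: y; exact: open_nbhs_nbhs.
Unshelve. all: end_near. Qed.

Lemma xgrad_off_closed (A : set 'rV[R]_n) k g x : closed A ->
  (forall y, ~ A y -> g y = 0) -> ~ A x -> xgrad k g x = 0.
Proof.
move=> cA g0 Ax; apply: big1 => i _.
by rewrite /partial (derive_off_closed _ cA g0 Ax) mulr0.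
Qed.

Lemma cube_closed (M : R) : closed (@cube R n M).
Proof. by apply: compact_closed; [exact: norm_hausdorff|exact: cube_compact]. Qed.

Lemma sum_continuous (X : topologicalType) (P : pred 'I_n) (f : 'I_n -> X -> R) (x : X) :
  (forall i, {for x, continuous (f i)}) ->
  {for x, continuous (fun y => \sum_(i < n | P i) f i y)}.
Proof.
by move=> cf; apply: cvg_big => [|i _]; [exact: add_continuous|exact: cf].
Qed.

Lemma line_continuous k : continuous (fun sx : R * 'rV[R]_n => sx.2 + sx.1 *: proj k sx.2).
Proof.
move=> [s x]; apply: (@cvg_rowP R _ (nbhs (s, x))) => i.
under eq_fun do rewrite !mxE; rewrite !mxE/=.
have cx : (fun sx : R * 'rV[R]_n => sx.2 0 i) @ nbhs (s, x) --> x 0 i.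
  apply: (@cvg_comp _ _ _ snd (fun y : 'rV[R]_n => y 0 i) _ (nbhs x)).
    exact: cvg_snd.
  exact: coord_continuous.
apply: cvgD => //; apply: cvgM; first exact: cvg_fst.
by case: ifP => // _; exact: cvg_cst.
Qed.

(** First-order expansion along the dilation field, uniform over the whole space: the mean value
    theorem gives the increment as [s * Q c x] with [|c| <= |s|], and [Q c x] is uniformly close to
    [Q 0 x] on a cube. *)
Lemma line_expansion k g (M e : R) : 0 < M -> vanishes_off M g ->
  (forall x, differentiable g x) -> (forall i, continuous (partial g i)) -> 0 < e ->
  \forall s \near (0 : R), forall x,
    `|g (x + s *: proj k x) - g x - s * xgrad k g x| <= e * `|s|.
Proof.
move=> M0 gM dg cg e0.
pose Q (s : R) x := \sum_(i < n | (i < k)%N) x 0 i * partial g i (x + s *: proj k x).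
have cQ x : {for (0, x), continuous (fun sx : R * 'rV[R]_n => Q sx.1 sx.2)}.
  apply: sum_continuous => i; apply: cvgM.
    apply: (@cvg_comp _ _ _ snd (fun y : 'rV[R]_n => y 0 i) _ (nbhs x)).
      exact: cvg_snd.
    exact: coord_continuous.
  apply: (@continuous_comp _ _ _ (fun sx : R * 'rV[R]_n => sx.2 + sx.1 *: proj k sx.2)).
    exact: line_continuous.
  exact: cg.
have /nbhs_ballP[d /= d0 hd] := compact_near_dist_lt (@cube_compact R n (2 * M))
  (fun x _ => cQ x) e0.
have Q0 x : Q 0 x = xgrad k g x.
  by apply: eq_bigr => i _; rewrite scale0r addr0.
have h20 : 0 < (2^-1 : R) by rewrite invr_gt0.
have B1 : \forall s \near (0 : R), `|s| < d.
  by apply/nbhs_ballP; exists d => //= s; rewrite /ball/= sub0r normrN.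
have B2 : \forall s \near (0 : R), `|s| < 2^-1.
  by apply/nbhs_ballP; exists 2^-1 => //= s; rewrite /ball/= sub0r normrN.
near=> s => x.
have sd : `|s| < d by near: s.
have s2 : `|s| < 2^-1 by near: s.
(* For [|s| < 1/2] a coordinate shrinks at most by half, so a point outside the cube of radius
   [2 * M] is moved to a point outside that of radius [M], and all terms vanish. *)
have [xM|xM] := pselect (cube (2 * M) x); last first.
  have xM1 : ~ cube M x by move=> h; apply: xM => i; rewrite (le_trans (h i))//; lra.
  have xsM : ~ cube M (x + s *: proj k x).
    move=> h; apply: xM => i; have := h i; rewrite !mxE => hi.
    have : `|x 0 i + s * (if (i < k)%N then x 0 i else 0)| >= `|x 0 i| / 2.
      case: ifP => _; last by rewrite mulr0 addr0 ler_pdivrMr// ler_peMr//; lra.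
      rewrite -{2}[x 0 i]mul1r -mulrDl normrM mulrC ler_wpM2r//.
      by move: s2; rewrite ltr_norml => /andP[? ?]; rewrite ger0_norm; lra.
    by lra.
  rewrite !gM// (xgrad_off_closed k (@cube_closed M) gM xM1).
  by rewrite mulr0 !subr0 normr0 mulr_ge0// ltW.
have dl (t : R) : is_derive t 1 (fun s : R => g (x + s *: proj k x)) (Q t x).
  by rewrite /Q -derive_proj//; exact: is_derive_line.
have cl : continuous (fun s : R => g (x + s *: proj k x)).
  move=> t; apply: differentiable_continuous; apply/derivable1_diffP.
  by have [] := dl t.
have [c cs E] : exists2 c, `|c| <= `|s| &
    g (x + s *: proj k x) - g x = Q c x * s.
  have [s0|s0] := leP 0 s.
    have [c c0s] := @MVT_segment R (fun s => g (x + s *: proj k x)) (Q ^~ x) 0 s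
      s0 (fun t _ => dl t) (continuous_subspaceT cl).
    rewrite scale0r addr0 subr0 => ->; exists c => //.
    by move: c0s; rewrite in_itv/= => /andP[? ?]; rewrite !ger0_norm.
  have [c c0s] := @MVT_segment R (fun s => g (x + s *: proj k x)) (Q ^~ x) s 0
      (ltW s0) (fun t _ => dl t) (continuous_subspaceT cl).
  rewrite scale0r addr0 sub0r => E; exists c.
    by move: c0s; rewrite in_itv/= => /andP[? ?]; rewrite !ler0_norm ?lerN2// ltW.
  by rewrite -[LHS]opprB E mulrN opprK.
rewrite E -Q0 mulrC -mulrBr normrM mulrC ler_wpM2r//.
apply: ltW; apply: hd => //.
by rewrite /ball/= sub0r normrN (le_lt_trans cs).
Unshelve. all: end_near. Qed.

(** Continuity is asked only on [U], since off the closed set [K] the function is locally 0. This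
    accommodates weights that are singular on [x' = 0]. *)
Lemma Cc_compact_support (K U : set 'rV[R]_n) g : compact K -> K `<=` U ->
  (forall x, ~ K x -> g x = 0) -> (forall x, U x -> {for x, continuous g}) -> Cc g.
Proof.
move=> cK KU gK cg.
have clK : closed K by apply: compact_closed => //; exact: norm_hausdorff.
split.
  move=> x; have [Kx|Kx] := pselect (K x); first exact/cg/KU.
  have oK : open (~` K) by exact: closed_openC.
  rewrite /continuous_at gK//; apply: (@cvg_near_cst _ _ _ _ (nbhs x)).
  have : nbhs x (~` K) by exact: open_nbhs_nbhs.
  by apply: filterS => y; exact: gK.
have [M [_ hM]] := compact_bounded cK.
exists (Num.max 1 (M + 1)); first by rewrite lt_max ltr01.
move=> x xM; apply: gK => Kx; apply: xM => i.
have : `|x| <= M + 1 by apply: (hM (M + 1)) => //; rewrite ltrDl.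
rewrite le_max => h; apply/orP; right; apply: le_trans h.
rewrite [leRHS]/Num.norm /= mx_normrE; apply/bigmax_geP; right => /=.
by exists (0, i).
Qed.

End Radial.

(** * Weighted densities and integration by parts *)

Section TestFunctions.
Variables (R : realType) (n k : nat) (u v : 'rV[R]_n -> R).
Hypothesis tf : test_fun k u v.
Implicit Types (g : 'rV[R]_n -> R) (x : 'rV[R]_n).

Lemma xnorm_ge0 x : 0 <= xnorm k x. Proof. exact: sqrtr_ge0. Qed.

Lemma xnorm_continuous : continuous (@xnorm R n k).
Proof.
move=> x; apply: (@continuous_comp _ _ _
  (fun x : 'rV[R]_n => \sum_(i < n | (i < k)%N) x 0 i ^+ 2) Num.sqrt).
  apply: sum_continuous => i.
  apply: (@continuous_comp _ _ _ (fun x : 'rV[R]_n => x 0 i) (fun a : R => a ^+ 2)).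
    exact: coord_continuous.
  exact: exprn_continuous.
exact: sqrt_continuous.
Qed.

Lemma xnorm_powR_continuous (e : R) x : xnorm k x != 0 ->
  {for x, continuous (fun y => xnorm k y `^ e)}.
Proof.
move=> x0; apply: (@cvg_powR _ _ (nbhs x)).
- exact: xnorm_ge0.
- exact: xnorm_ge0.
- by rewrite lt_def x0 xnorm_ge0.
- exact: xnorm_continuous.
Qed.

Lemma smooth_differentiable g : smooth g -> forall x, differentiable g x.
Proof. by move=> sg x; exact: (sg [::] x). Qed.

Lemma smooth_continuous g : smooth g -> continuous g.
Proof.
by move=> sg x; apply: differentiable_continuous; exact: smooth_differentiable.
Qed.

Lemma smooth_partial_continuous g i : smooth g -> continuous (partial g i).
Proof.
by move=> sg x; apply: differentiable_continuous; exact: (sg [:: delta_mx 0 i] x).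
Qed.

Lemma smooth_xgrad_continuous g : smooth g -> continuous (xgrad k g).
Proof.
move=> sg x; apply: sum_continuous => i.
apply: (@continuousM _ _ (fun x : 'rV[R]_n => x 0 i) (partial g i)).
  exact: coord_continuous.
exact: smooth_partial_continuous.
Qed.

Let su : smooth u. Proof. by case: tf. Qed.
Let sv : smooth v. Proof. by case: tf => _ []. Qed.

Lemma Cc_test g :
  (forall x, u x = 0 -> v x = 0 -> xgrad k u x = 0 -> xgrad k v x = 0 -> g x = 0) ->
  (forall x, xnorm k x != 0 -> {for x, continuous g}) -> Cc g.
Proof.
move=> g0 cg; have [_ [_ [K [cK [KU uv0]]]]] := tf.
have clK : closed K by apply: compact_closed => //; exact: norm_hausdorff.
apply: (Cc_compact_support cK KU) => // x Kx.
have [u0 v0] := uv0 x Kx; apply: g0 => //.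
  by apply: (xgrad_off_closed k clK _ Kx) => y /uv0[].
by apply: (xgrad_off_closed k clK _ Kx) => y /uv0[].
Qed.

(** Needed where powers of [xnorm k x] are combined: on the axis exponents cannot be added freely,
    but there the function itself vanishes. *)
Lemma test_axis x : xnorm k x = 0 ->
  [/\ u x = 0, v x = 0, xgrad k u x = 0 & xgrad k v x = 0].
Proof.
move=> x0; have [_ [_ [K [cK [KU uv0]]]]] := tf.
have clK : closed K by apply: compact_closed => //; exact: norm_hausdorff.
have Kx : ~ K x by move=> /KU/=; rewrite x0 eqxx.
have [u0 v0] := uv0 x Kx; split => //.
  by apply: (xgrad_off_closed k clK _ Kx) => y /uv0[].
by apply: (xgrad_off_closed k clK _ Kx) => y /uv0[].
Qed.

Lemma Cc_test_u : Cc u.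
Proof. by apply: Cc_test => // x _; exact: smooth_continuous. Qed.

Lemma Cc_test_v : Cc v.
Proof. by apply: Cc_test => // x _; exact: smooth_continuous. Qed.

Definition wdens (s e : R) x := cabs (Defs.cscale (xnorm k x `^ e) (cfun u v x)) `^ s.

Lemma wdensE (s e : R) x : wdens s e x = (xnorm k x `^ e * cabs (u x, v x)) `^ s.
Proof. by rewrite /wdens cabsZ ger0_norm ?powR_ge0. Qed.

Lemma wnormE (s e : R) : wnorm k s e u v = RintRn (wdens s e) `^ s^-1.
Proof. by []. Qed.

Lemma wnorm_ge0 (s e : R) : 0 <= wnorm k s e u v.
Proof. exact: powR_ge0. Qed.

Lemma wdens_ge0 s e x : 0 <= wdens s e x.
Proof. exact: powR_ge0. Qed.

Lemma Cc_wdens (s e : R) : 0 < s -> Cc (wdens s e).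
Proof.
move=> s0; apply: Cc_test => [x u0 v0 _ _|x x0].
  by rewrite wdensE u0 v0 cabs0 mulr0 powR0// gt_eqF.
have -> : wdens s e = (fun x => (xnorm k x `^ e * cabs (u x, v x)) `^ s).
  by apply/funext => y; rewrite wdensE.
apply: (@cvg_powR _ _ (nbhs x)).
- by move=> y; rewrite mulr_ge0 ?powR_ge0 ?cabs_ge0.
- by rewrite mulr_ge0 ?powR_ge0 ?cabs_ge0.
- by rewrite s0 orbT.
- apply: cvgM; first exact: xnorm_powR_continuous.
  by apply: cvg_cabs; exact: smooth_continuous.
Qed.

Lemma xnorm_line (s : R) x : 0 < 1 + s -> xnorm k (x + s *: proj k x) = (1 + s) * xnorm k x.
Proof.
move=> s0; rewrite /xnorm -[X in X * _]ger0_norm ?ltW// -sqrtr_sqr -sqrtrM ?sqr_ge0//.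
rewrite mulr_sumr; congr Num.sqrt; apply: eq_bigr => i ik.
by rewrite !mxE ik -exprMn mulrDl mul1r.
Qed.

Lemma line_dilate (s : R) x :
  x + s *: proj k x = dilate (fun i : 'I_n => if (i < k)%N then 1 + s else 1) x.
Proof.
apply/rowP => i; rewrite !mxE; case: ifP => _; first by rewrite mulrDl mul1r.
by rewrite mulr0 addr0 mul1r.
Qed.

Lemma prod_line (s : R) : (k <= n)%N ->
  \prod_(i < n) (if (i < k)%N then 1 + s else 1) = (1 + s) ^+ k.
Proof.
move=> kn; rewrite -big_mkcond/= -(big_ord_widen n (fun=> 1 + s) kn).
by rewrite prodr_const card_ord.
Qed.

Variables (p alpha : R).
Hypothesis p1 : 1 < p.

Let p0 : 0 < p. Proof. by apply: lt_trans p1. Qed.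

Definition weight x : R := (xnorm k x `^ (alpha / p))^-1.

Lemma weight_ge0 x : 0 <= weight x. Proof. by rewrite invr_ge0 powR_ge0. Qed.

Lemma weightE x : weight x = xnorm k x `^ (- (alpha / p)).
Proof. by rewrite powRN. Qed.

Lemma weight_continuous x : xnorm k x != 0 -> {for x, continuous weight}.
Proof.
move=> x0; rewrite (_ : weight = fun y => xnorm k y `^ (- (alpha / p))).
  exact: xnorm_powR_continuous.
by apply/funext => y; rewrite weightE.
Qed.

Lemma weight_powR_continuous x : xnorm k x != 0 ->
  {for x, continuous (fun y => weight y `^ p)}.
Proof.
move=> x0; apply: (@cvg_powR _ _ (nbhs x)).
- exact: weight_ge0.
- exact: weight_ge0.
- by rewrite p0 orbT.
- exact: weight_continuous.
Qed.

Local Notation dens := (wdens p (- (alpha / p))).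

Lemma densE x : dens x = weight x `^ p * cabs (u x, v x) `^ p.
Proof. by rewrite wdensE -weightE powRM ?weight_ge0 ?cabs_ge0. Qed.

(** With [flux2], the real and imaginary parts of [|x'|^-alpha |f|^(p-2) f]. *)
Definition flux1 x := weight x `^ p * (cabs (u x, v x) `^ (p - 2) * u x).
Definition flux2 x := weight x `^ p * (cabs (u x, v x) `^ (p - 2) * v x).

Lemma Cc_flux1 : Cc flux1.
Proof.
apply: Cc_test => [x u0 v0 _ _|x x0]; first by rewrite /flux1 u0 !mulr0.
apply: (@continuousM _ _ (fun y => weight y `^ p) (fun y => cabs (u y, v y) `^ (p - 2) * u y)).
  exact: weight_powR_continuous.
apply: (@cvg_cabs_powRM _ _ (nbhs x)) => //; try exact: smooth_continuous.
- by move=> y; exact: (normr1_le_cabs (u y, v y)).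
- exact: (normr1_le_cabs (u x, v x)).
Qed.

Lemma Cc_flux2 : Cc flux2.
Proof.
apply: Cc_test => [x u0 v0 _ _|x x0]; first by rewrite /flux2 v0 !mulr0.
apply: (@continuousM _ _ (fun y => weight y `^ p) (fun y => cabs (u y, v y) `^ (p - 2) * v y)).
  exact: weight_powR_continuous.
apply: (@cvg_cabs_powRM _ _ (nbhs x)) => //; try exact: smooth_continuous.
- by move=> y; exact: (normr2_le_cabs (u y, v y)).
- exact: (normr2_le_cabs (u x, v x)).
Qed.

(** This is [|x'|^-alpha |f|^(p-2) Re(conj f . x'.nabla_k f)], formally [1/p] times
    [|x'|^-alpha x'.nabla_k |f|^p]. *)
Definition cross x := xgrad k u x * flux1 x + xgrad k v x * flux2 x.

Lemma Cc_cross : Cc cross.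
Proof.
apply: CcD; apply: CcMl; try exact: smooth_xgrad_continuous.
  exact: Cc_flux1.
exact: Cc_flux2.
Qed.

(** Only [f] is dilated. Homogeneity of the weight contributes [(1 + s)^alpha], and the Jacobian of
    a dilation of [k] coordinates contributes [(1 + s)^-k]. *)
Lemma RintRn_dens_line (s : R) : (k <= n)%N -> 0 < 1 + s ->
  let h := fun x => weight x `^ p * cabs (u (x + s *: proj k x), v (x + s *: proj k x)) `^ p in
  Cc h /\ RintRn h = (1 + s) `^ (alpha - k%:R) * RintRn dens.
Proof.
move=> kn s0 h; set d := fun i : 'I_n => if (i < k)%N then 1 + s else 1.
have d0 i : 0 < d i by rewrite /d; case: ifP.
have hE : h = fun x => (1 + s) `^ alpha * (dens \o dilate d) x.
  apply/funext => x; rewrite /h /= -line_dilate densE /weight xnorm_line//.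
  rewrite powRM ?xnorm_ge0 ?ltW// invfM powRM ?invr_ge0 ?powR_ge0//.
  rewrite -[X in _ = _ * (X `^ p * _ * _)]powRN -powRrM mulNr divfK ?gt_eqF//.
  rewrite !mulrA -powRD ?subrr ?powRr0 ?mul1r//.
  by rewrite (gt_eqF s0) implybT.
have cd : Cc dens by exact: Cc_wdens.
split; first by rewrite hE; apply: CcZ; exact: Cc_dilate.
rewrite hE RintRnZ; last exact: Cc_dilate.
rewrite RintRn_dilate// /d prod_line// mulrA; congr (_ * _).
rewrite powRB ?(gt_eqF s0) ?implybT//; congr (_ / _).
by rewrite powR_mulrn// ltW.
Qed.

(* Integration by parts for the dilation field [x' . nabla_k]: the integral of
   [|x'|^-alpha |f_s|^p], with [f_s] the dilated function, is an explicit power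
   of [1 + s], and convexity of [|.|^p] bounds its increment from below to first
   order in [s] for both signs of [s]. *)
Lemma RintRn_cross : (k <= n)%N -> p * RintRn cross = (alpha - k%:R) * RintRn dens.
Proof.
move=> kn; set L := alpha - k%:R; set I := RintRn dens.
have I0 : 0 <= I by apply: RintRn_ge0 => x; exact: wdens_ge0.
have cd : Cc dens by exact: Cc_wdens.
have [cu [Mu Mu0 uM]] := Cc_test_u; have [cv [Mv Mv0 vM]] := Cc_test_v.
have [c1 [M1 M10 f1M]] := Cc_flux1; have [c2 [M2 M20 f2M]] := Cc_flux2.
have [B1 hB1] := Cc_bounded Cc_flux1; have [B2 hB2] := Cc_bounded Cc_flux2.
have B10 : 0 <= B1 by exact: le_trans (hB1 0).
have B20 : 0 <= B2 by exact: le_trans (hB2 0).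
pose M := Num.max M1 M2.
have M0 : 0 < M by rewrite lt_max M10.
pose C := p * ((B1 + B2) * (2 * M) ^+ n) + I.
have C0 : 0 <= C.
  by rewrite addr_ge0// mulr_ge0 ?(ltW p0)// mulr_ge0 ?addr_ge0// exprn_ge0 ?mulr_ge0 ?(ltW M0).
pose d := L * I - p * RintRn cross.
suff dle e : 0 < e -> `|d| <= C * e.
  apply/eqP; rewrite eq_sym -subr_eq0 -/d -normr_le0; apply/ler_addgt0Pl => e e0.
  have C10 : 0 < C + 1 by rewrite ltr_wpDl.
  apply: (le_trans (dle (e / (C + 1)) _)); first by rewrite divr_gt0.
  by rewrite addr0 mulrCA ler_piMr ?(ltW e0)// ler_pdivrMr// mul1r lerDl.
move=> e0.
have key : \forall s \near (0 : R), - (C * e) * `|s| <= s * d.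
  have Pu := line_expansion k Mu0 uM (smooth_differentiable su)
    (fun i => smooth_partial_continuous (i := i) su) e0.
  have Pv := line_expansion k Mv0 vM (smooth_differentiable sv)
    (fun i => smooth_partial_continuous (i := i) sv) e0.
  have PL : \forall s \near (0 : R), `|(1 + s) `^ L - 1 - s * L| <= e * `|s|.
    have dL : is_derive (1 : R) 1 (fun t : R => t `^ L) (L * 1 `^ (L - 1)).
      exact: is_derive1_powR.
    have [dv dE] := dL; rewrite powR1 mulr1 in dE.
    have : (fun h : R => h^-1 *: (((fun t : R => t `^ L) \o shift 1) (h *: 1) - 1 `^ L))
        @ 0^' --> 'D_1 (fun t : R => t `^ L) 1 by exact: dv.
    rewrite dE => /cvgrPdist_le /(_ _ e0).
    rewrite /at_right !near_withinE; apply: filterS => s /= hs.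
    have [->|s0] := eqVneq s 0.
      by rewrite addr0 powR1 subrr mul0r subr0 normr0 mulr0.
    have := hs s0; rewrite powR1 [s *: 1]mulr1 -[s^-1 *: _]/(s^-1 * _) => {}hs.
    have -> : (1 + s) `^ L - 1 - s * L = - (s * (L - s^-1 * ((s + 1) `^ L - 1))).
      by rewrite [s + 1]addrC; field.
    by rewrite normrN normrM mulrC ler_wpM2r.
  have P1 : \forall s \near (0 : R), 0 < 1 + s.
    by apply/nbhs_ballP; exists 1 => //= s; rewrite /ball/= sub0r normrN ltr_norml; lra.
  near=> s.
  have hu x : `|u (x + s *: proj k x) - u x - s * xgrad k u x| <= e * `|s| by move: x; near: s.
  have hv x : `|v (x + s *: proj k x) - v x - s * xgrad k v x| <= e * `|s| by move: x; near: s.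
  have hL : `|(1 + s) `^ L - 1 - s * L| <= e * `|s| by near: s.
  have s1 : 0 < 1 + s by near: s.
  have [ch Jh] := RintRn_dens_line kn s1.
  set h := fun x => _ in ch Jh.
  pose ru x := u (x + s *: proj k x) - u x - s * xgrad k u x.
  pose rv x := v (x + s *: proj k x) - v x - s * xgrad k v x.
  have cr g : continuous g -> continuous (xgrad k g) ->
      continuous (fun x => g (x + s *: proj k x) - g x - s * xgrad k g x).
    move=> cg cxg x.
    apply: (@continuousB _ _ _ (fun x => g (x + s *: proj k x) - g x) (fun x => s * xgrad k g x)).
      apply: (@continuousB _ _ _ (fun x => g (x + s *: proj k x)) g); last exact: cg.
      apply: (@continuous_comp _ _ _ (fun x => x + s *: proj k x) g); last exact: cg.
      rewrite (_ : (fun x => _) = dilate (fun i : 'I_n => if (i < k)%N then 1 + s else 1)).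
        exact: dilate_continuous.
      by apply/funext => y; rewrite line_dilate.
    by apply: (@continuousM _ _ (fun=> s) (xgrad k g)); [exact: cst_continuous|exact: cxg].
  pose err x := ru x * flux1 x + rv x * flux2 x.
  have cerr : Cc err.
    apply: CcD; apply: CcMl.
    - by apply: cr => //; exact: smooth_xgrad_continuous.
    - exact: Cc_flux1.
    - by apply: cr => //; exact: smooth_xgrad_continuous.
    - exact: Cc_flux2.
  have errM : `|RintRn err| <= e * `|s| * (B1 + B2) * (2 * M) ^+ n.
    apply: RintRn_bound => //.
      move=> x xM; rewrite /err.
      rewrite (vanishes_off_le _ f1M xM) ?le_max ?lexx//.
      by rewrite (vanishes_off_le _ f2M xM) ?le_max ?lexx ?orbT// !mulr0 addr0.
    move=> x; apply: (le_trans (ler_normD _ _)).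
    rewrite mulrDr (normrM (ru x)) (normrM (rv x)).
    apply: lerD; apply: ler_pM; first
      [exact: normr_ge0|exact: hu|exact: hv|exact: hB1|exact: hB2].
  (* The tangent inequality at [f x] towards the dilated value, times the weight; the increment of
     [f] is split into [s] times its derivative along the field and the remainder [ru], [rv]. *)
  have ineq x : dens x + (p * s * cross x + p * err x) <= h x.
    have := cabs_powR_tangent (u x, v x) (u (x + s *: proj k x), v (x + s *: proj k x)) p1.
    move=> /(ler_wpM2l (powR_ge0 (weight x) p)); rewrite -/(h x).
    congr (_ <= _).
    rewrite densE /cross /err /flux1 /flux2 /ru /rv /cRe_mul_conj /=; ring.
  have cpe : Cc (fun x => p * s * cross x + p * err x).
    by apply: CcD; apply: CcZ => //; exact: Cc_cross.
  have := ler_RintRn (CcD cd cpe) ch ineq.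
  rewrite RintRnD// RintRnD ?RintRnZ//;
    try (by apply: CcZ => //; exact: Cc_cross); last exact: Cc_cross.
  rewrite Jh -/I -/L => H.
  have H1 : - (p * (e * `|s| * (B1 + B2) * (2 * M) ^+ n)) <= p * RintRn err.
    rewrite -mulrN ler_pM2l//; move: errM; rewrite ler_norml => /andP[] //.
  have H2 : ((1 + s) `^ L - 1 - s * L) * I <= e * `|s| * I.
    by rewrite ler_wpM2r// (le_trans (ler_norm _)).
  rewrite /C /d; move: H H1 H2.
  set Y := (1 + s) `^ L; set J1 := RintRn err; set J2 := RintRn cross; set Z := (2 * M) ^+ n.
  move=> H H1 H2; lra.
(* The values [s = r / 2] and [s = - (r / 2)], after division by [r / 2], bound [d] from below and
   from above by [C * e]. *)
have /nbhs_ballP[r /= r0 hr] := key.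
have r20 : 0 < r / 2 by rewrite divr_gt0.
have rr : r / 2 < r by rewrite ltr_pdivrMr// ltr_pMr//; lra.
have k1 : - (C * e) * `|r / 2| <= r / 2 * d.
  by apply: hr; rewrite /ball/= sub0r normrN gtr0_norm.
have k2 : - (C * e) * `|- (r / 2)| <= - (r / 2) * d.
  by apply: hr; rewrite /ball/= sub0r opprK gtr0_norm.
rewrite normrN gtr0_norm// in k2; rewrite gtr0_norm// in k1.
rewrite ler_norml; apply/andP; split.
  by rewrite -(ler_pM2l r20) mulrC.
by rewrite -(ler_pM2l r20); lra.
Unshelve. all: end_near. Qed.

End TestFunctions.

(** * The bracket and the interpolation inequality *)

Section Bracket.
Variables (R : realType) (n k : nat) (u v : 'rV[R]_n -> R) (p alpha : R).
Hypotheses (tf : test_fun k u v) (p1 : 1 < p) (kn : (k <= n)%N).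

Local Notation m := ((k%:R - alpha) / p).
Local Notation dens := (wdens k u v p (- (alpha / p))).
Local Notation weight := (@weight R n k p alpha).

Let p0 : 0 < p. Proof. by apply: lt_trans p1. Qed.

Let powRB2 (a : R) : a != 0 -> a `^ p = a `^ (p - 2) * a `^ 2.
Proof. by move=> a0; rewrite -powRD ?subrK// a0 implybT. Qed.

(** The difference of the two arguments is [- m * weight x] times [f], so its modulus is
    [|m| * weight x * |f|]. When the arguments coincide, one of these three factors is 0, and the
    right side reduces to the first power as well. *)
Lemma Cp_gradw x : Cp p (gradw k p alpha u v x) (gradw_shift k p alpha u v x) =
  cabs (gradw k p alpha u v x) `^ p -
  (`|m| `^ p * (1 - p) * dens x - p * `|m| `^ (p - 2) * m * cross k u v p alpha x).
Proof.
rewrite densE//.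
have -> : gradw_shift k p alpha u v x = (weight x * xgrad k u x + m * weight x * u x,
    weight x * xgrad k v x + m * weight x * v x) by [].
have -> : gradw k p alpha u v x = (weight x * xgrad k u x, weight x * xgrad k v x) by [].
have sq : cabs (u x, v x) ^+ 2 = u x ^+ 2 + v x ^+ 2 by exact: sqr_cabs.
rewrite /Cp /cross /flux1 /flux2.
have := weight_ge0 k p alpha x; have := cabs_ge0 (u x, v x).
have := cabs_eq0 (u x, v x).
move: sq; set c := cabs (u x, v x); set a := weight x.
set A := xgrad k u x; set B := xgrad k v x; set U := u x; set V := v x.
move=> sq c_eq0 c0 a0.
set eta := (a * A + m * a * U, a * B + m * a * V); set xi := (a * A, a * B).
have subE : csub xi eta = Defs.cscale (- (m * a)) (U, V).
  by rewrite /csub /Defs.cscale/=; congr pair; ring.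
have absE : cabs (csub xi eta) = `|m| * a * c.
  by rewrite subE cabsZ normrN normrM (ger0_norm a0).
rewrite -addrA -opprD; congr (_ - _); rewrite absE.
have [xe|xe] := eqVneq xi eta.
  have : `|m| * a * c == 0.
    by rewrite -absE cabs_eq0 xe /csub !subrr.
  rewrite !mulf_eq0 normr_eq0 -orbA => /or3P[m0|/eqP a00|c00].
  - rewrite (eqP m0) normr0 mulr0 !mul0r !powR0 ?gt_eqF//; ring.
  - rewrite a00 mulr0 !mul0r !powR0 ?gt_eqF//; ring.
  - move: (c00); rewrite c_eq0 => /eqP[-> ->].
    by rewrite (eqP c00) !mulr0 powR0 ?gt_eqF//; ring.
have nz : `|m| * a * c != 0.
  apply: contra xe; rewrite -absE cabs_eq0 /csub xpair_eqE !subr_eq0.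
  by case: xi eta {subE absE} => ? ? [? ?].
move: (nz); rewrite !mulf_eq0 !negb_or => /andP[/andP[m0 a00] c00].
rewrite !powRM ?mulr_ge0 ?normr_ge0// (powRB2 m0) (powRB2 a00) (powRB2 c00).
rewrite !(powR_mulrn 2) ?normr_ge0// sq real_normK ?num_real//.
rewrite subE /cRe_mul_conj/=; ring.
Qed.

Lemma Cc_gradw : Cc (fun x => cabs (gradw k p alpha u v x) `^ p).
Proof.
have [su [sv _]] := tf.
have E : (fun x => cabs (gradw k p alpha u v x) `^ p) =
    fun x => (weight x * cabs (xgrad k u x, xgrad k v x)) `^ p.
  by apply/funext => x; rewrite cabsZ ger0_norm// weight_ge0.
rewrite E; apply: (Cc_test tf) => [x _ _ A0 B0|x x0].
  by rewrite A0 B0 cabs0 mulr0 powR0// gt_eqF.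
apply: (@cvg_powR _ _ (nbhs x)).
- by move=> y; rewrite mulr_ge0 ?weight_ge0 ?cabs_ge0.
- by rewrite mulr_ge0 ?weight_ge0 ?cabs_ge0.
- by rewrite p0 orbT.
- apply: cvgM; first exact: weight_continuous.
  by apply: cvg_cabs; exact: smooth_xgrad_continuous.
Qed.

Lemma bracketE : bracket k p alpha u v = `|m| `^ p * RintRn dens.
Proof.
have cd : Cc dens by exact: Cc_wdens.
have cc : Cc (cross k u v p alpha) by exact: Cc_cross.
have cg := Cc_gradw.
set a := `|m| `^ p * (1 - p); set b := p * `|m| `^ (p - 2) * m.
have cab : Cc (fun x => a * dens x - b * cross k u v p alpha x).
  by apply: CcB; exact: CcZ.
rewrite /bracket /LnormRn -/(RintRn (fun x => cabs (gradw k p alpha u v x) `^ p)).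
rewrite -powRrM mulVf ?gt_eqF// powRr1; last by apply: RintRn_ge0 => x; exact: powR_ge0.
rewrite -/(RintRn (fun x => Cp p (gradw k p alpha u v x) (gradw_shift k p alpha u v x))).
rewrite (_ : (fun x => Cp _ _ _) = fun x => cabs (gradw k p alpha u v x) `^ p -
    (a * dens x - b * cross k u v p alpha x)); last first.
  by apply/funext => x; rewrite Cp_gradw.
rewrite RintRnB// opprB addrC subrK RintRnB; [|exact: CcZ|exact: CcZ].
rewrite !RintRnZ//.
have := RintRn_cross tf alpha p1 kn; set I := RintRn dens => H.
(* Integration by parts, with [alpha - k = - p * m]. *)
have -> : RintRn (cross k u v p alpha) = - m * I.
  apply: (mulfI (lt0r_neq0 p0)); rewrite H; field.
  by rewrite gt_eqF.
rewrite /a /b; have [m0|m0] := eqVneq m 0.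
  by rewrite m0 normr0 powR0 ?gt_eqF//; ring.
have -> : `|m| `^ p = `|m| `^ (p - 2) * m ^+ 2.
  by rewrite powRB2 ?normr_eq0// powR_mulrn// real_normK// num_real.
ring.
Qed.

End Bracket.

Section Inequality.
Variables (R : realType) (n k : nat) (u v : 'rV[R]_n -> R) (p q r delta alpha b : R).
Hypotheses (tf : test_fun k u v) (kn : (k <= n)%N).
Hypotheses (p1 : 1 < p) (q1 : 1 < q) (r0 : 0 < r).
Hypotheses (delta01 : 0 <= delta <= 1).
Hypothesis homog : delta * r / p + (1 - delta) * r / q = 1.

Local Notation m := ((k%:R - alpha) / p).
Local Notation dens := (wdens k u v).

Let p0 : 0 < p. Proof. by apply: lt_trans p1. Qed.
Let q0 : 0 < q. Proof. by apply: lt_trans q1. Qed.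

(** Hölder with [t = delta * r / p]; the homogeneity relation says exactly that
    [1 - t = (1 - delta) * r / q]. The formula for [c] makes the exponents of [|x'|] add up. At
    [delta = 0] or [1] the weight [t] degenerates, but [r] equals [q] or [p] and both sides
    coincide. *)
Lemma wnorm_interpolation :
  wnorm k r (alpha * (- delta + b * (1 - delta)) / p) u v <=
  wnorm k p (- (alpha / p)) u v `^ delta * wnorm k q (alpha * b / p) u v `^ (1 - delta).
Proof.
have /andP[d0 d1] := delta01.
have [d00|dn0] := eqVneq delta 0.
  have rq : r = q.
    by move: homog; rewrite d00 !mul0r add0r subr0 mul1r => /divr1_eq.
  rewrite d00 subr0 oppr0 add0r mulr1 rq.
  have := wnorm_ge0 k u v q (alpha * b / p).
  generalize (wnorm k q (alpha * b / p) u v) (wnorm k p (- (alpha / p)) u v).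
  by move=> N N' N0; rewrite powRr0 mul1r powRr1.
have [d11|dn1] := eqVneq delta 1.
  have rp : r = p.
    by move: homog; rewrite d11 subrr !mul0r addr0 mul1r => /divr1_eq.
  have -> : alpha * (- delta + b * (1 - delta)) / p = - (alpha / p) by rewrite d11; ring.
  rewrite d11 subrr rp.
  have := wnorm_ge0 k u v p (- (alpha / p)).
  generalize (wnorm k p (- (alpha / p)) u v) (wnorm k q (alpha * b / p) u v).
  by move=> N N' N0; rewrite powRr0 mulr1 powRr1.
pose t := delta * r / p.
have tE : 1 - t = (1 - delta) * r / q.
  by apply/eqP; rewrite subr_eq addrC; apply/eqP; rewrite homog.
have dgt0 : 0 < delta by rewrite lt_def dn0.
have dlt1 : 0 < 1 - delta by rewrite subr_gt0 lt_def eq_sym dn1.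
have t0 : 0 < t by rewrite divr_gt0// mulr_gt0.
have t1 : 0 < 1 - t by rewrite tE divr_gt0// mulr_gt0.
have t01 : 0 < t < 1 by rewrite t0 -subr_gt0.
have pt : p * t = delta * r by rewrite mulrC divfK ?gt_eqF.
have qt : q * (1 - t) = (1 - delta) * r by rewrite tE mulrC divfK ?gt_eqF.
have E : dens r (alpha * (- delta + b * (1 - delta)) / p) =
   fun x => dens p (- (alpha / p)) x `^ t * dens q (alpha * b / p) x `^ (1 - t).
  apply/funext => x; rewrite !wdensE.
  rewrite -!powRrM pt qt.
  have [x0|x0] := eqVneq (xnorm k x) 0.
    have [-> -> _ _] := test_axis tf x0.
    by rewrite cabs0 !mulr0 !powR0 ?mulr0// gt_eqF// mulr_gt0.
  have c0 := cabs_ge0 (u x, v x).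
  rewrite !powRM ?powR_ge0// -!powRrM mulrACA -!powRD ?x0 ?implybT//; last first.
    by apply/implyP; rewrite -mulrDl addrC subrK mul1r gt_eqF.
  congr (_ `^ _ * _ `^ _); last by ring.
  by field; rewrite gt_eqF.
have powers (A B C : R) : 0 <= A -> 0 <= B -> 0 <= C -> C <= A `^ t * B `^ (1 - t) ->
    C `^ r^-1 <= (A `^ p^-1) `^ delta * (B `^ q^-1) `^ (1 - delta).
  move=> A0 B0 C0 H; have ri0 : 0 <= r^-1 by rewrite invr_ge0 ltW.
  apply: (le_trans (ge0_ler_powR ri0 _ _ H)).
  - by rewrite nnegrE.
  - by rewrite nnegrE mulr_ge0 ?powR_ge0.
  rewrite powRM ?powR_ge0// -!powRrM tE /t.
  have -> : delta * r / p / r = p^-1 * delta by field; rewrite !gt_eqF.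
  have -> // : (1 - delta) * r / q / r = q^-1 * (1 - delta) by field; rewrite !gt_eqF.
rewrite !wnormE; apply: powers.
- by apply: RintRn_ge0 => x; exact: wdens_ge0.
- by apply: RintRn_ge0 => x; exact: wdens_ge0.
- by apply: RintRn_ge0 => x; exact: wdens_ge0.
have cr : Cc (dens r (alpha * (- delta + b * (1 - delta)) / p)) by exact: Cc_wdens.
rewrite E in cr *; apply: RintRn_hoelder => //.
- by move=> x; exact: wdens_ge0.
- by move=> x; exact: wdens_ge0.
- exact: Cc_wdens.
- exact: Cc_wdens.
Qed.

Lemma bracket_powR : bracket k p alpha u v `^ (delta / p) =
  `|m| `^ delta * wnorm k p (- (alpha / p)) u v `^ delta.
Proof.
rewrite bracketE// powRM ?powR_ge0//; last by apply: RintRn_ge0 => x; exact: wdens_ge0.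
rewrite wnormE -!powRrM; congr (_ `^ _ * _ `^ _); last by rewrite mulrC.
by rewrite mulrC divfK ?gt_eqF.
Qed.

End Inequality.

(** * A smooth bump function *)

Section Flat.
Variable R : realType.

(* [t^-m exp(-1/t)] for [t > 0], written as one exponential so that the chain
   rule gives the recurrence [flat_is_derive] at once. *)
Definition flat (m : nat) (t : R) : R :=
  if 0 < t then expR (- t^-1 - m%:R * ln t) else 0.

Lemma flat_ge0 m t : 0 <= flat m t.
Proof. by rewrite /flat; case: ifP => // _; exact: expR_ge0. Qed.

Lemma flat_gt0 m t : 0 < t -> 0 < flat m t.
Proof. by rewrite /flat => ->; exact: expR_gt0. Qed.

Lemma flat_le0 m t : t <= 0 -> flat m t = 0.
Proof. by rewrite /flat ltNge => ->. Qed.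

Lemma flatS m t : 0 < t -> flat m.+1 t = flat m t / t.
Proof.
move=> t0; have -> : flat m t / t = flat m t * expR (- ln t) by rewrite expRN lnK.
rewrite /flat t0 -expRD.
by congr expR; rewrite -natr1; ring.
Qed.

Lemma flatE m t : 0 < t -> flat m t = expR (- t^-1) / t ^+ m.
Proof.
move=> t0; elim: m => [|m IH]; first by rewrite /flat t0 mul0r subr0 expr0 divr1.
by rewrite flatS// IH exprSr invfM mulrA.
Qed.

Lemma flat_le_sqr m t : flat m t <= m.+2`!%:R * t ^+ 2.
Proof.
have [t0|t0] := leP t 0.
  by rewrite flat_le0// mulr_ge0// sqr_ge0.
have f0 : 0 < (m.+2`!%:R : R) by rewrite ltr0n fact_gt0.
have ti0 : 0 <= t^-1 by rewrite invr_ge0 ltW.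
have := expR_ge1Dxn m.+1 ti0 => h.
have {}h : t^-1 ^+ m.+2 / m.+2`!%:R <= expR t^-1.
  by apply: le_trans h; rewrite lerDr.
rewrite flatE// expRN ler_pdivrMr ?exprn_gt0// -[leLHS]mul1r ler_pdivrMr ?expR_gt0//.
have tm : 0 < m.+2`!%:R * t ^+ 2 * t ^+ m by rewrite !mulr_gt0 ?exprn_gt0.
apply: le_trans (ler_wpM2l (ltW tm) h).
set C := m.+2`!%:R in f0 *.
have -> : C * t ^+ 2 * t ^+ m * (t^-1 ^+ m.+2 / C) = (t * t^-1) ^+ m.+2 * (C / C).
  rewrite exprMn -[t ^+ m.+2]/(t ^+ (2 + m)) exprD.
  by move: (t^-1 ^+ m.+2) C^-1 (t ^+ 2) (t ^+ m) => *; ring.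
by rewrite !mulfV ?gt_eqF// expr1n mul1r.
Qed.

Lemma flat_is_derive (m : nat) (t : R) : is_derive t 1 (flat m) (flat m.+2 t - m%:R * flat m.+1 t).
Proof.
have [t0|t0|t0] := ltrgtP t 0.
- rewrite !flat_le0 ?ltW// mulr0 subr0.
  apply: (@near_eq_is_derive _ _ _ (cst 0)) => //.
  near=> s; rewrite flat_le0// ltW//; near: s; exact: lt_nbhsl.
- have -> : flat m.+2 t - m%:R * flat m.+1 t =
      expR (- t^-1 - m%:R * ln t) * (t ^- 2 - m%:R * t^-1).
    rewrite !flatS// /flat t0; field; exact: lt0r_neq0.
  apply: (@near_eq_is_derive _ _ _ (expR \o (fun s => - s^-1 - m%:R * ln s))).
    by near=> s; rewrite /flat (_ : 0 < s)//; near: s; exact: lt_nbhsr.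
  apply: is_derive1_comp.
  have d1 : is_derive t 1 (fun s : R => s^-1) (- t ^- 2 *: 1).
    by apply: is_deriveV; rewrite ?gt_eqF.
  have d2 : is_derive t 1 (@ln R) t^-1 by exact: is_derive1_ln.
  have -> : t ^- 2 - m%:R * t^-1 = - (- t ^- 2 *: 1) - m%:R *: t^-1.
    by rewrite [_ *: 1]mulr1 opprK.
  exact: is_deriveB.
- rewrite t0 !flat_le0// mulr0 subr0.
  have cv : (fun h : R => h^-1 *: ((flat m \o shift 0) (h *: 1) - flat m 0)) @ 0^' --> (0 : R).
    apply/cvgrPdist_le => e e0.
    have C0 : 0 < (m.+2`!%:R : R) by rewrite ltr0n fact_gt0.
    have : \forall h \near (0 : R), `|h| < e / m.+2`!%:R.
      by apply/nbhs_ballP; exists (e / m.+2`!%:R) => /=;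
        [exact: divr_gt0|move=> h; rewrite /ball/= sub0r normrN].
    rewrite near_withinE; apply: filterS => h he h0 /=.
    rewrite (flat_le0 m (lexx 0)) subr0 addr0 [h *: 1]mulr1 sub0r normrN.
    rewrite -[h^-1 *: _]/(h^-1 * _) normrM normfV (ger0_norm (flat_ge0 _ _)).
    rewrite mulrC ler_pdivrMr ?normr_gt0//.
    apply: (le_trans (flat_le_sqr _ _)).
    rewrite -(real_normK (num_real h)) expr2 mulrA ler_wpM2r//.
    by rewrite mulrC -ler_pdivlMr// ltW.
  split; first by apply/cvg_ex; exists 0.
  exact: cvg_lim cv.
Unshelve. all: end_near. Qed.

(** A class containing the bump and closed under every directional derivative; differentiability of
    all iterated derivatives then follows by induction on the list of directions, with no formula
    for them. *)
Inductive elementary n : ('rV[R]_n -> R) -> Prop :=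
| elementary_cst c : elementary (cst c)
| elementary_coord i : elementary (fun x : 'rV[R]_n => x 0 i)
| elementary_add f g : elementary f -> elementary g -> elementary (f + g)
| elementary_mul f g : elementary f -> elementary g -> elementary (f * g)
| elementary_flat m f : elementary f -> elementary (flat m \o f).

Lemma elementary_derive n (f : 'rV[R]_n -> R) : elementary f ->
  (forall x, differentiable f x) /\ (forall v, elementary ('D_v f)).
Proof.
elim=> {f} [c|i|f g ef [df Df] eg [dg Dg]|f g ef [df Df] eg [dg Dg]|m f ef [df Df]].
- split=> [x|v]; first exact: differentiable_cst.
  have -> : 'D_v (cst c) = cst 0 :> ('rV[R]_n -> R).
    by apply/funext => x; rewrite derive_cst.
  exact: elementary_cst.
- split=> [x|v]; first exact: differentiable_coord.
  have -> : 'D_v (fun x : 'rV[R]_n => x 0 i) = cst (v 0 i).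
    apply/funext => x; apply: cvg_lim => //.
    apply: (@cvg_near_cst _ _ _ _ (0^')).
    rewrite near_withinE; apply: nearW => h h0 /=.
    by rewrite !mxE addrK -[_ *: _]/(_ * _) mulKf.
  exact: elementary_cst.
- split=> [x|v]; first exact: differentiableD.
  have -> : 'D_v (f + g) = 'D_v f + 'D_v g.
    by apply/funext => x; rewrite deriveD//; exact: diff_derivable.
  exact: elementary_add.
- split=> [x|v]; first exact: differentiableM.
  have -> : 'D_v (f * g) = f * 'D_v g + g * 'D_v f.
    by apply/funext => x; rewrite deriveM//; exact: diff_derivable.
  by apply: elementary_add; exact: elementary_mul.
- have dflat t : differentiable (flat m) t.
    by apply/derivable1_diffP; have [] := flat_is_derive m t.
  split=> [x|v]; first exact: differentiable_comp.
  have -> : 'D_v (flat m \o f) =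
      ((flat m.+2 \o f) + cst (- m%:R) * (flat m.+1 \o f)) * 'D_v f.
    apply/funext => x; rewrite deriveE; last exact: differentiable_comp.
    rewrite diff_comp//= diff1E// derive1E.
    have [_ ->] := flat_is_derive m (f x).
    rewrite -deriveE//.
    rewrite -[RHS]/((flat m.+2 (f x) + - m%:R * flat m.+1 (f x)) * 'D_v f x).
    by rewrite -[LHS]/('D_v f x * _); ring.
  apply: elementary_mul => //; apply: elementary_add; first exact: elementary_flat.
  by apply: elementary_mul; [exact: elementary_cst|exact: elementary_flat].
Qed.

Lemma elementary_smooth n (f : 'rV[R]_n -> R) : elementary f -> smooth f.
Proof.
move=> ef vs; elim: vs f ef => [|v vs IH] f ef x /=.
  by have [] := elementary_derive ef.
by apply: IH; have [_] := elementary_derive ef.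
Qed.

Lemma elementary_sum n (I : Type) (s : seq I) (f : I -> 'rV[R]_n -> R) :
  (forall i, elementary (f i)) -> elementary (\sum_(i <- s) f i).
Proof.
move=> ef; elim: s => [|i s IH]; first by rewrite big_nil; exact: elementary_cst.
by rewrite big_cons; exact: elementary_add.
Qed.

(** The bump is centred at the first basis vector, whose nonzero coordinate belongs to [x'] because
    [1 <= k]. It is positive there, which makes all its weighted norms positive. *)
Lemma exists_test_fun n k : (1 <= k <= n)%N -> exists u v : 'rV[R]_n -> R,
  test_fun k u v /\ forall s e : R, 0 < s -> 0 < wnorm k s e u v.
Proof.
move=> /andP[k1 kn]; have n0 : (0 < n)%N by exact: leq_trans kn.
pose i0 : 'I_n := Ordinal n0.
pose x0 : 'rV[R]_n := delta_mx 0 i0.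
pose dist := \sum_(i < n) ((fun x : 'rV[R]_n => x 0 i) + cst (- x0 0 i)) *
  ((fun x : 'rV[R]_n => x 0 i) + cst (- x0 0 i)).
(* Positive exactly in the ball of radius [1/2] about [x0], where the first coordinate exceeds
   [1/2]; the support stays away from [x' = 0]. *)
pose q : 'rV[R]_n -> R := cst (4^-1) + cst (-1) * dist.
have qE x : q x = 4^-1 - \sum_(i < n) (x 0 i - x0 0 i) ^+ 2.
  rewrite -[LHS]/(4^-1 + -1 * dist x) mulN1r /dist fct_sumE; congr (_ - _).
have elq : elementary q.
  apply: elementary_add; first exact: elementary_cst.
  apply: elementary_mul; first exact: elementary_cst.
  apply: elementary_sum => i; apply: elementary_mul;
    by apply: elementary_add; [exact: elementary_coord|exact: elementary_cst].
have xn (x : 'rV[R]_n) : x 0 i0 != 0 -> xnorm k x != 0.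
  move=> xi; rewrite gt_eqF// sqrtr_gt0 (bigD1 i0)//= ltr_pwDl//.
    by rewrite exprn_even_gt0.
  by rewrite sumr_ge0// => i _; rewrite sqr_ge0.
have x00 : x0 0 i0 = 1 by rewrite mxE !eqxx.
have tf : test_fun k (flat 0 \o q) (cst 0).
  split; first exact/elementary_smooth/elementary_flat.
  split; first exact/elementary_smooth/elementary_cst.
  exists [set x | forall i, `[x0 0 i - 2^-1, x0 0 i + 2^-1]%classic (x 0 i)].
  split.
    apply: (@rV_compact R n (fun i => `[x0 0 i - 2^-1, x0 0 i + 2^-1]%classic)) => i.
    exact: segment_compact.
  split=> [x /(_ i0)/=|x xK].
    by rewrite x00 in_itv/= => /andP[h _]; apply: xn; rewrite gt_eqF//; lra.
  split => //=; rewrite flat_le0// leNgt; apply/negP => qx; apply: xK => i.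
  have : (x 0 i - x0 0 i) ^+ 2 <= 4^-1.
    move: qx; rewrite qE subr_gt0 (bigD1 i)//= => /ltW; apply: le_trans.
    by rewrite lerDl sumr_ge0// => j _; rewrite sqr_ge0.
  rewrite -(_ : (2^-1) ^+ 2 = 4^-1 :> R); last by field.
  rewrite -[X in X <= _]real_normK ?num_real// ler_sqr ?nnegrE ?normr_ge0 ?invr_ge0//.
  by rewrite ler_norml => /andP[h1 h2]; rewrite /= in_itv/=; apply/andP; split; lra.
exists (flat 0 \o q), (cst 0); split => // s e s0.
have ux0 : 0 < flat 0 (q x0).
  by apply: flat_gt0; rewrite qE big1 ?subr0// => i _; rewrite subrr expr0n.
have X0 : 0 < xnorm k x0.
  by rewrite lt_def xn ?x00 ?oner_eq0// sqrtr_ge0.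
rewrite wnormE powR_gt0//; apply: (RintRn_gt0 (x0 := x0)).
- exact: Cc_wdens.
- by move=> x; exact: wdens_ge0.
- rewrite wdensE powR_gt0// mulr_gt0 ?powR_gt0//.
  by apply: lt_le_trans (normr1_le_cabs _); rewrite /= gtr0_norm.
Qed.

End Flat.

Theorem theorem5p1 (R : realType) (n k : nat) (p q r delta alpha b c : R) :
  (1 <= k <= n)%N -> 1 < p -> 1 < q -> 0 < r -> r <= p + q ->
  0 <= delta <= 1 -> (r - q) / r <= delta <= p / r ->
  delta * r / p + (1 - delta) * r / q = 1 ->
  c = - delta + b * (1 - delta) ->
  (forall u v : 'rV[R]_n -> R, test_fun k u v ->
     0 <= bracket k p alpha u v /\
     `|(k%:R - alpha) / p| `^ delta * wnorm k r (alpha * c / p) u v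
       <= bracket k p alpha u v `^ (delta / p)
          * wnorm k q (alpha * b / p) u v `^ (1 - delta)) /\
  (alpha != k%:R ->
   ((q = p /\ b = -1) \/ delta = 0 \/ delta = 1) ->
   forall K : R, `|(k%:R - alpha) / p| `^ delta < K ->
   exists u v : 'rV[R]_n -> R, test_fun k u v /\
     bracket k p alpha u v `^ (delta / p)
       * wnorm k q (alpha * b / p) u v `^ (1 - delta)
     < K * wnorm k r (alpha * c / p) u v).
Proof.
move=> kn1 p1 q1 r0 _ d01 _ homog ->; have /andP[_ kn] := kn1.
split=> [u v tf|_ cases K hK].
  split.
    by rewrite bracketE// mulr_ge0 ?powR_ge0//; apply: RintRn_ge0 => x; exact: wdens_ge0.
  rewrite bracket_powR// -[leRHS]mulrA; apply: ler_wpM2l; first exact: powR_ge0.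
  exact: wnorm_interpolation.
have [u [v [tf N0]]] := exists_test_fun R kn1.
exists u, v; split => //; rewrite bracket_powR//.
(* Equality for the chosen function suffices: its [L^r] norm is positive, so replacing the constant
   by a larger [K] makes the right side strictly larger. *)
suff -> : `|(k%:R - alpha) / p| `^ delta * wnorm k p (- (alpha / p)) u v `^ delta *
    wnorm k q (alpha * b / p) u v `^ (1 - delta) =
    `|(k%:R - alpha) / p| `^ delta * wnorm k r (alpha * (- delta + b * (1 - delta)) / p) u v.
  by rewrite ltr_pM2r// N0.
rewrite -[LHS]mulrA; congr (_ * _).
case: cases => [[qp b1]|[d0|d1]].
(* With [q = p] homogeneity forces [r = p], and [b = -1] gives [c = -1]: the three norms are the
   same, and its powers [delta] and [1 - delta] recombine. *)
- have rp : r = p.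
    by move: homog; rewrite qp -!mulrDl addrC subrK mul1r => /divr1_eq.
  have -> : alpha * (- delta + b * (1 - delta)) / p = - (alpha / p) by rewrite b1; ring.
  have -> : alpha * b / p = - (alpha / p) by rewrite b1; ring.
  rewrite qp rp; have := wnorm_ge0 k u v p (- (alpha / p)).
  generalize (wnorm k p (- (alpha / p)) u v) => N N_ge0.
  by rewrite -powRD addrC subrK ?oner_eq0// powRr1.
- have rq : r = q.
    by move: homog; rewrite d0 !mul0r add0r subr0 mul1r => /divr1_eq.
  rewrite d0 subr0 oppr0 add0r mulr1 rq.
  have := wnorm_ge0 k u v q (alpha * b / p).
  generalize (wnorm k q (alpha * b / p) u v) (wnorm k p (- (alpha / p)) u v).
  by move=> N N' N_ge0; rewrite powRr0 mul1r powRr1.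
- have rp : r = p.
    by move: homog; rewrite d1 subrr !mul0r addr0 mul1r => /divr1_eq.
  have -> : alpha * (- delta + b * (1 - delta)) / p = - (alpha / p) by rewrite d1; ring.
  rewrite d1 subrr rp.
  have := wnorm_ge0 k u v p (- (alpha / p)).
  generalize (wnorm k p (- (alpha / p)) u v) (wnorm k q (alpha * b / p) u v).
  by move=> N N' N_ge0; rewrite powRr0 mulr1 powRr1.
Qed.
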